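(* Let $\alpha>1$ be the constant of the power function $s\mapsto s^{\alpha}$. For the non-preemptive speed-scaling scheduling problem $P|size_j,W_j=W,size_j\le \frac{m}{2},energy|\sum C_j$ (rigid jobs on $m$ identical parallel processors, each job $j$ requiring $size_j\le\frac m2$ processors, with the same work $W$ per utilized processor for all jobs, minimizing the total completion time $\sum_j C_j$ under a given energy budget $E$), a $2$-approximate schedule can be found in polynomial time.
   Context: Model. A set of jobs $\mathcal{J}=\{1,\dots,n\}$ is to be scheduled non-preemptively on $m$ speed-scalable parallel processors, each of which processes at most one job at a time; $n$ and $m$ are part of the input. Each job $j$ is a rigid job: it is given with an integer $size_j$ and a total processing volume (work) $V_j$, and it must be processed simultaneously on $size_j$ processors, where any subset of $size_j$ processors may be used. The work is divided uniformly among the processors used: each of the $size_j$ processors executes work $W_j=V_j/size_j$, and all of them run at the same speed while executing job $j$. Any positive real speed is available. A processor running at speed $s$ consumes energy at rate (power) $s^{\alpha}$, where $\alpha>1$ is a constant; thus if job $j$ is run at constant speed with duration $p_j>0$, it consumes energy $size_j\, W_j^{\alpha}\,p_j^{1-\alpha}$. The scheduler chooses the speeds (durations), the processors and the start times. A schedule is feasible if the total energy consumption of all jobs is at most the given energy budget $E$. All jobs are available at time $0$; $C_j$ denotes the completion time of job $j$, and the goal is to minimize $\sum_{j\in\mathcal{J}} C_j$ over feasible schedules. In the problem of the claim, every instance satisfies $size_j\le\frac m2$ and $W_j=W$ (i.e. $V_j=W\cdot size_j$) for all $j$, for some common value $W>0$. A $\rho$-approximate schedule is a feasible schedule (in particular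 with energy consumption at most $E$) whose total completion time is at most $\rho$ times the minimum total completion time over all feasible schedules. *)

(* Defs.v *)
From HB Require Import structures.
From mathcomp Require Import all_boot all_order all_algebra.
From mathcomp Require Import all_classical all_reals exp.
Set Implicit Arguments.
Unset Strict Implicit.
Unset Printing Implicit Defensive.
Import Order.TTheory GRing.Theory Num.Theory.
Local Open Scope ring_scope.

(** * Scheduling of rigid jobs with speed scaling *)

Record instance (R : realType) := Instance {
  njobs : nat;
  nproc : nat;
  jsize : 'I_njobs -> nat;
  volume : 'I_njobs -> R;
  budget : R
}.

Definition well_formed (R : realType) (I : instance R) : Prop :=
  [/\ forall j : 'I_(njobs I), (0 < jsize j)%N,
      forall j : 'I_(njobs I), 0 < volume j
    & 0 < budget I].

(* W_j, the work executed by each of the processors used by job j *)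
Definition work (R : realType) (I : instance R) (j : 'I_(njobs I)) : R :=
  volume j / (jsize j)%:R.

(* size_j <= m / 2 and W_j = W *)
Definition half_size_equal_work (R : realType) (I : instance R) : Prop :=
  (forall j : 'I_(njobs I), (2 * jsize j <= nproc I)%N) /\
  (exists2 W : R, 0 < W & forall j : 'I_(njobs I), work j = W).

Record schedule (R : realType) (I : instance R) := Schedule {
  start : 'I_(njobs I) -> R;
  duration : 'I_(njobs I) -> R;
  procs : 'I_(njobs I) -> {set 'I_(nproc I)}
}.

Section Schedules.
Variables (R : realType) (alpha : R) (I : instance R).
Implicit Types S : schedule I.

Definition speed S (j : 'I_(njobs I)) : R := work j / duration S j.

(* size_j processors, each with power speed^alpha, during the duration p_j;
   this equals size_j * W_j^alpha * p_j^(1 - alpha). *)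
Definition job_energy S (j : 'I_(njobs I)) : R :=
  (jsize j)%:R * powR (speed S j) alpha * duration S j.

Definition energy S : R := \sum_j job_energy S j.

Definition completion S (j : 'I_(njobs I)) : R := start S j + duration S j.

Definition total_completion S : R := \sum_j completion S j.

Definition feasible S : Prop :=
  [/\ forall j, 0 <= start S j /\ 0 < duration S j,
      forall j, #|procs S j| = jsize j,
      forall i j, i != j -> ~~ [disjoint procs S i & procs S j] ->
        completion S i <= start S j \/ completion S j <= start S i
    & energy S <= budget I].

Definition opt_total_completion : R :=
  inf [set total_completion S | S in [set S | feasible S]]%classic.

Definition approx_schedule (rho : R) S : Prop :=
  feasible S /\ total_completion S <= rho * opt_total_completion.

End Schedules.

(** * A real RAM

    A memory consists of finitely many (per program) named infinite arrays of
    natural numbers and of real numbers; cells are addressed by computed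
    natural numbers.  On natural numbers only addition, truncated subtraction
    and comparison are available, so that T unit-cost steps only produce
    numbers of bit length O(T + input).  On real numbers the field
    operations, comparison, the embedding of natural numbers and three fixed
    powers are available; there is no conversion from reals to naturals.
    Programs contain no real constants. *)

(* The exponent alpha is that of the power function s |-> s^alpha, 1/alpha that
   of its inverse, and 1/(alpha-1) that of the inverse of its derivative (up to
   a constant factor). *)
Inductive exponent := Ealpha | Einv_alpha | Einv_alpha_pred.

Inductive nexp :=
  | Nconst of nat
  | Nget of nat & nexp            (* array name, index *)
  | Nadd of nexp & nexp
  | Nsub of nexp & nexp.

Inductive rexp :=
  | Rofnat of nexp
  | Ralpha
  | Rget of nat & nexp            (* array name, index *)
  | Radd of rexp & rexp
  | Ropp of rexp
  | Rmul of rexp & rexp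
  | Rinv of rexp
  | Rpow of exponent & rexp.

Inductive bexp :=
  | Bnle of nexp & nexp
  | Brle of rexp & rexp
  | Bnot of bexp
  | Band of bexp & bexp.

Inductive cmd :=
  | Cskip
  | Cnset of nat & nexp & nexp    (* array name, index, value *)
  | Crset of nat & nexp & rexp    (* array name, index, value *)
  | Cseq of cmd & cmd
  | Cif of bexp & cmd & cmd
  | Cwhile of bexp & cmd.

Record state (R : realType) := State {
  nmem : nat -> nat -> nat;
  rmem : nat -> nat -> R
}.

Definition upd (T : Type) (f : nat -> nat -> T) (a i : nat) (v : T) :
    nat -> nat -> T :=
  fun a' i' => if (a' == a) && (i' == i) then v else f a' i'.

Section Semantics.
Variables (R : realType) (alpha : R).
Implicit Types s : state R.

Definition exponent_val (e : exponent) : R :=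
  match e with
  | Ealpha => alpha
  | Einv_alpha => alpha^-1
  | Einv_alpha_pred => (alpha - 1)^-1
  end.

Fixpoint neval s (e : nexp) : nat :=
  match e with
  | Nconst c => c
  | Nget a e1 => nmem s a (neval s e1)
  | Nadd e1 e2 => (neval s e1 + neval s e2)%N
  | Nsub e1 e2 => (neval s e1 - neval s e2)%N
  end.

Fixpoint reval s (e : rexp) : R :=
  match e with
  | Rofnat e1 => (neval s e1)%:R
  | Ralpha => alpha
  | Rget a e1 => rmem s a (neval s e1)
  | Radd e1 e2 => reval s e1 + reval s e2
  | Ropp e1 => - reval s e1
  | Rmul e1 e2 => reval s e1 * reval s e2
  | Rinv e1 => (reval s e1)^-1
  | Rpow x e1 => powR (reval s e1) (exponent_val x)
  end.

Fixpoint beval s (e : bexp) : bool :=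
  match e with
  | Bnle e1 e2 => (neval s e1 <= neval s e2)%N
  | Brle e1 e2 => reval s e1 <= reval s e2
  | Bnot e1 => ~~ beval s e1
  | Band e1 e2 => beval s e1 && beval s e2
  end.

(* [exec c s t s'] : from s, the program c halts in state s' after t steps, a
   step being an assignment or the evaluation of a test.  The expressions
   evaluated in one step have sizes bounded by a constant of the program. *)
Inductive exec : cmd -> state R -> nat -> state R -> Prop :=
  | exec_skip s : exec Cskip s 1 s
  | exec_nset s a i e :
      exec (Cnset a i e) s 1
        (State (upd (nmem s) a (neval s i) (neval s e)) (rmem s))
  | exec_rset s a i e :
      exec (Crset a i e) s 1
        (State (nmem s) (upd (rmem s) a (neval s i) (reval s e)))
  | exec_seq c1 c2 s1 s2 s3 t1 t2 :
      exec c1 s1 t1 s2 -> exec c2 s2 t2 s3 ->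
      exec (Cseq c1 c2) s1 (t1 + t2) s3
  | exec_if b c1 c2 s s' t :
      exec (if beval s b then c1 else c2) s t s' ->
      exec (Cif b c1 c2) s t.+1 s'
  | exec_while_stop b c s :
      ~~ beval s b -> exec (Cwhile b c) s 1 s
  | exec_while_step b c s1 s2 s3 t1 t2 :
      beval s1 b -> exec c s1 t1 s2 -> exec (Cwhile b c) s2 t2 s3 ->
      exec (Cwhile b c) s1 (t1 + t2).+1 s3.

End Semantics.

(** * Input and output conventions

    Input, all other cells being 0:
      natural array 0: n at index 0 and m at index 1;
      natural array 1: size_j at index j;
      real array 0: E at index 0;
      real array 1: V_j at index j.
    Output:
      real array 2: start time of job j at index j;
      real array 3: duration of job j at index j;
      natural array 2: K at index 0;
      natural arrays 3, 4, 5: for each k < K a triple (j, lo, hi), meaning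
        that job j uses the processors lo, ..., hi - 1.
    Processor sets are written as unions of intervals since m is given in
    binary. *)

Definition of_fun (T : Type) (n : nat) (x0 : T) (f : 'I_n -> T) (i : nat) : T :=
  oapp f x0 (insub i).

Definition encode_instance (R : realType) (I : instance R) : state R :=
  State
    (fun a i => match a with
       | 0%N => nth 0%N [:: njobs I; nproc I] i
       | 1%N => of_fun 0%N (@jsize R I) i
       | _ => 0%N
       end)
    (fun a i => match a with
       | 0%N => nth 0 [:: budget I] i
       | 1%N => of_fun 0 (@volume R I) i
       | _ => 0
       end).

Definition decode_schedule (R : realType) (I : instance R) (s : state R) :
    schedule I :=
  @Schedule R I
    (fun j => rmem s 2 j)
    (fun j => rmem s 3 j)
    (fun j => [set p : 'I_(nproc I) |
       [exists k : 'I_(nmem s 2 0),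
          (nmem s 3 k == j) && (nmem s 4 k <= p < nmem s 5 k)%N]]).

Definition bit_length (k : nat) : nat := (trunc_log 2 k).+1.

(* naturals are counted with their binary length, reals with one cell *)
Definition input_size (R : realType) (I : instance R) : nat :=
  (bit_length (njobs I) + bit_length (nproc I) + 1
   + \sum_(j < njobs I) (bit_length (jsize j) + 1))%N.

(* Main.v *)
Require Import Defs.
From mathcomp Require Import all_boot all_order all_algebra all_fingroup.
From mathcomp Require Import all_classical all_reals sequences exp.
From mathcomp Require Import zify ring lra.
Set Implicit Arguments.
Unset Strict Implicit.
Unset Printing Implicit Defensive.
Import Order.TTheory GRing.Theory Num.Theory.
Local Open Scope ring_scope.

(** A job of size s and duration p has area s p.  On each processor the jobs are
    disjoint, so that by Cauchy-Schwarz every set of jobs of total area a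
    satisfies [sum (area * midpoint) >= a^2 / (2 m)].  Summation by parts along
    nondecreasing areas turns this into a lower bound [sum_i B_i p_i] on the total
    completion time, where [B_i = s_i (n - i - 1/2) / m + 1/2] for the job in
    position i (counted from 0).  For a fixed order, minimizing this linear form
    under the energy budget has a closed-form solution, [p_i] being proportional
    to [(s_i / B_i)^(1/alpha)]; a supermodularity argument shows that the order by
    nondecreasing sizes is the best one.

    With these durations, which are nondecreasing in i, the jobs are assigned to
    the processors cyclically, each starting when the last job it overlaps has
    completed.  If job i waits for job k, then jobs k, ..., i - 1 cover more than
    m - s_i >= m / 2 processors and are at least as long as job k; inductively
    the start of job i is at most [2 / m] times the area of its predecessors, and
    summing up gives twice the lower bound. *)

(** * Inequalities *)

(** Writing [r / r^alpha] as [exp ((1 - alpha) ln r)], use [exp x >= 1 + x] and then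
    [ln r <= r - 1]. Equality holds at [r = 1]. *)
Lemma addr_powR_ge (R : realType) (alpha r : R) :
  1 < alpha -> 0 < r -> alpha <= (alpha - 1) * r + r / powR r alpha.
Proof.
move=> a1 r0; have rE : r / powR r alpha = expR ((1 - alpha) * ln r).
  by rewrite -{1}(powRr1 (ltW r0)) -powRB ?(gt_eqF r0) ?implybT// /powR gt_eqF.
have := expR_ge1Dx ((1 - alpha) * ln r); rewrite -rE.
have : ln r <= r - 1.
  have := expR_ge1Dx (ln r); rewrite lnK ?posrE//; lra.
nra.
Qed.

(** Concavity of [u^g] through its tangent at [w]; multiplying by [w] avoids the exponent
    [g - 1]. *)
Lemma powR_tangent (R : realType) (g w u : R) : 0 <= g <= 1 -> 0 < w -> 0 < u ->
  w * powR u g <= powR w g * (w + g * (u - w)).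
Proof.
move=> /andP[g0 g1] w0 u0.
rewrite /powR !gt_eqF//.
(* the tangent of exp at g ln u + (1 - g) ln w, evaluated at ln u and ln w *)
have tanE (a x : R) : expR a * (1 + (x - a)) <= expR x.
  have := expR_ge1Dx (x - a); rewrite expRB ler_pdivlMr ?expR_gt0//.
  by rewrite mulrC.
have := tanE (g * ln u + (1 - g) * ln w) (ln u).
have := tanE (g * ln u + (1 - g) * ln w) (ln w).
rewrite !lnK ?posrE//.
set e := expR _ => H1 H2.
have He : e <= g * u + (1 - g) * w by nra.
have -> : w * expR (g * ln u) = expR (g * ln w) * e.
  rewrite /e -expRD -{1}(lnK w0) -expRD; congr expR; ring.
by apply: ler_wpM2l; [exact: expR_ge0 | lra].
Qed.

(** The tangent bounds at [w] for [a] and [b] are combined with weights [b - w] and [w - a], so that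
    the slopes cancel. *)
Lemma powR_concave (R : realType) (g a w b : R) : 0 <= g <= 1 ->
  0 < a -> a <= w -> w <= b ->
  (b - w) * powR a g + (w - a) * powR b g <= (b - a) * powR w g.
Proof.
move=> g01 a0 aw wb; have w0 := lt_le_trans a0 aw; have b0 := lt_le_trans w0 wb.
rewrite -(ler_pM2l w0).
have := powR_tangent g01 w0 a0; have := powR_tangent g01 w0 b0.
set pa := powR a g; set pb := powR b g; set pw := powR w g => Hb Ha.
have := ler_wpM2l (_ : 0 <= b - w) Ha; have := ler_wpM2l (_ : 0 <= w - a) Hb.
rewrite !subr_ge0 => /(_ aw) Hb' /(_ wb) Ha'.
lra.
Qed.

(** Both [z] and [z' + d] lie between [z'] and [z + d]; their two chord bounds add up to the claim
    times [z + d - z']. *)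
Lemma powR_increment (R : realType) (g z z' d : R) : 0 <= g <= 1 ->
  0 < z' -> z' <= z -> 0 <= d ->
  powR (z + d) g - powR z g <= powR (z' + d) g - powR z' g.
Proof.
move=> g01 z0 zz d0.
have [D0|] := ltP 0 (z + d - z'); last first.
  by move=> D0; have -> : z' = z by lra.
have := @powR_concave _ g z' z (z + d) g01 z0 zz ltac:(lra).
have := @powR_concave _ g z' (z' + d) (z + d) g01 z0 ltac:(lra) ltac:(lra).
move=> H1 H2; rewrite -(ler_pM2l D0); lra.
Qed.

(** Weak duality for an assignment problem with a Monge cost matrix: the potentials are feasible and
    tight on the diagonal, and their sum does not depend on [pi]. *)
Lemma rearrangement (R : realDomainType) (n : nat) (G : nat -> nat -> R)
    (pi : {perm 'I_n}) :
  (forall l i j, (l.+1 < n)%N -> (i <= j < n)%N ->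
     G l.+1 j - G l j <= G l.+1 i - G l i) ->
  \sum_(i < n) G i i <= \sum_(i < n) G (pi i) i.
Proof.
move=> HG.
(* dual potentials of the assignment problem *)
pose u j := \sum_(0 <= l < j) (G l.+1 l - G l l).
have HGu i j : (i < n)%N -> (j < n)%N -> u j + (G i i - u i) <= G j i.
  move=> lti ltj; have tele a b : (a <= b)%N ->
      u b - u a = \sum_(a <= l < b) (G l.+1 l - G l l).
    move=> ab; rewrite /u (big_cat_nat (leq0n a) ab)/=. lra.
  have [ij|/ltnW ji] := leqP i j.
    have : u j - u i <= G j i - G i i.
      rewrite tele// -(telescope_sumr (G ^~ i)) // big_nat [leRHS]big_nat.
      by apply: ler_sum => l /andP[il lj]; apply: HG; lia.
    lra.
  have : G i i - G j i <= u i - u j.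
    rewrite tele// -(telescope_sumr (G ^~ i)) // big_nat [leRHS]big_nat.
    by apply: ler_sum => l /andP[il lj]; apply: HG; lia.
  lra.
apply: (@le_trans _ _ (\sum_(i < n) (u (pi i) + (G i i - u i)))); last first.
  by apply: ler_sum => i _; apply: HGu.
rewrite big_split/= sumrB.
have -> : \sum_(i < n) u (pi i) = \sum_(i < n) u i.
  by rewrite [RHS](reindex_inj (@perm_inj _ pi)).
lra.
Qed.

(** Double counting: [b l] enters the prefix sums of the [n - l - 1] later indices, and once more
    with factor 1/2. *)
Lemma sum_suffix_weights (R : numFieldType) (n : nat) (b : nat -> R) :
  \sum_(i < n) (\sum_(l < i) b l + b i / 2)
  = \sum_(i < n) ((n - i)%:R - 2^-1) * b i.
Proof.
elim: n => [|n IH]; first by rewrite !big_ord0.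
rewrite big_ord_recr IH /= [RHS]big_ord_recr /= subSnn.
have -> : \sum_(i < n) ((n.+1 - i)%:R - 2^-1) * b i
   = \sum_(i < n) ((n - i)%:R - 2^-1) * b i + \sum_(i < n) b i.
  rewrite -big_split; apply: eq_bigr => i _ /=.
  by rewrite subSn 1?ltnW// -natr1; ring.
rewrite mulr1n -!addrA; congr (_ + (_ + _)).
by field.
Qed.

(* [D k] is the slack of the k-th hypothesis; since the loads [b] are
   nondecreasing, summation by parts only drops nonnegative multiples of it. *)
Lemma sum_of_prefix_squares (R : realFieldType) (n : nat) (m : R)
    (b M : nat -> R) :
  0 < m -> (forall i, (i < n)%N -> 0 < b i) ->
  (forall i j, (i <= j < n)%N -> b i <= b j) ->
  (forall k, (k <= n)%N ->
     (\sum_(i < k) b i) ^+ 2 <= 2 * m * \sum_(i < k) b i * M i) ->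
  \sum_(i < n) ((n - i)%:R - 2^-1) * b i <= m * \sum_(i < n) M i.
Proof.
move=> m0 b0 bmono H; rewrite -sum_suffix_weights.
pose D k := 2 * m * \sum_(i < k) b i * M i - (\sum_(i < k) b i) ^+ 2.
have D0 k : (k <= n)%N -> 0 <= D k by move=> kn; rewrite subr_ge0 H.
case: n => [|n] in b0 bmono H D0 *; first by rewrite !big_ord0 mulr0.
(* Stronger claim for the induction: the last slack is at most twice the last load times the slack
   of the conclusion. *)
suff : D n.+1 <= 2 * b n * (m * \sum_(i < n.+1) M i
                 - \sum_(i < n.+1) (\sum_(l < i) b l + b i / 2)).
  move/(le_trans (D0 _ (leqnn _))); rewrite pmulr_rge0 ?subr_ge0//.
  by rewrite mulr_gt0 ?b0.
elim: n => [|n IH] in b0 bmono H D0 *.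
  rewrite /D !big_ord1 big_ord0; lra.
set Z := m * \sum_(i < n.+1) M i
         - \sum_(i < n.+1) (\sum_(l < i) b l + b i / 2).
have HZ : D n.+1 <= 2 * b n * Z.
  apply: IH => [i ?|i j ?|k ?|k ?].
  - by apply: b0; lia.
  - by apply: bmono; lia.
  - by apply: H; lia.
  - by apply: D0; lia.
have -> : m * \sum_(i < n.+2) M i - \sum_(i < n.+2) (\sum_(l < i) b l + b i / 2)
  = Z + (m * M n.+1 - (\sum_(l < n.+1) b l + b n.+1 / 2)).
  rewrite /Z [\sum_(i < n.+2) M i]big_ord_recr
    [\sum_(i < n.+2) (_ + _)]big_ord_recr /=; ring.
have DE : D n.+2 = D n.+1
   + 2 * b n.+1 * (m * M n.+1 - (\sum_(l < n.+1) b l + b n.+1 / 2)).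
  rewrite /D [\sum_(i < n.+2) b i]big_ord_recr
    [\sum_(i < n.+2) _ * _]big_ord_recr /=; by field.
rewrite DE [leRHS]mulrDr lerD2r.
have b1 : 0 < b n by apply: b0; lia.
have b12 : b n <= b n.+1 by apply: bmono; lia.
(* Since [Z] is nonnegative, its factor [2 * b n] may be raised to [2 * b n.+1]. *)
have : 0 <= Z by have := le_trans (D0 n.+1 ltac:(lia)) HZ; rewrite pmulr_rge0 ?mulr_gt0.
nra.
Qed.

(** * Lower bound *)

(** The strict lexicographic order by [f] and then by index, so that ranks are distinct even for
    equal values. It is phrased with [<=] only, the comparison available to programs. *)
Definition precedes (d : Order.disp_t) (T : orderType d) (n : nat)
    (f : 'I_n -> T) (k i : 'I_n) : bool :=
  (f k <= f i)%O && ~~ ((f i <= f k)%O && (i <= k)%N).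

Definition rank (d : Order.disp_t) (T : orderType d) (n : nat)
    (f : 'I_n -> T) (i : 'I_n) : nat :=
  \sum_(k < n) precedes f k i.

Lemma precedes_trans d (T : orderType d) n (f : 'I_n -> T) :
  transitive (precedes f).
Proof.
rewrite /precedes => j i k /andP[ij nij] /andP[jk njk].
rewrite (le_trans ij jk) /=; apply/negP => /andP[ki leki].
move: nij njk; rewrite (le_trans jk ki) (le_trans ki ij) /=; lia.
Qed.

Lemma precedes_total d (T : orderType d) n (f : 'I_n -> T) i j :
  i != j -> precedes f i j || precedes f j i.
Proof.
rewrite -val_eqE /precedes /=; case: ltgtP => //= _; lia.
Qed.

Lemma ltn_rank d (T : orderType d) n (f : 'I_n -> T) i j :
  precedes f i j -> (rank f i < rank f j)%N.
Proof.
move=> ij; rewrite /rank (bigD1 i)//= [ltnRHS](bigD1 i)//= ij.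
have -> : precedes f i i = false by rewrite /precedes lexx leqnn.
rewrite add0n add1n ltnS; apply: leq_sum => k _.
by case E : (precedes f k i) => //; rewrite (precedes_trans E ij).
Qed.

Lemma rank_lt d (T : orderType d) n (f : 'I_n -> T) i : (rank f i < n)%N.
Proof.
rewrite /rank (bigD1 i)//=.
have -> : precedes f i i = false by rewrite /precedes lexx leqnn.
apply: (@leq_ltn_trans (\sum_(k < n | k != i) 1)).
  by apply: leq_sum => k _; case: precedes.
by rewrite sum1_card cardC1 card_ord; case: n i {f} => [[]|].
Qed.

Lemma rank_inj d (T : orderType d) n (f : 'I_n -> T) : injective (rank f).
Proof.
move=> i j eqr; apply/eqP/negPn/negP => /(precedes_total f).
by case/orP => /ltn_rank; rewrite eqr ltnn.
Qed.

(** The rank is an injection of ['I_n] into itself; its inverse sends a position to the job there.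
    It serves for areas in the lower bound and for sizes in the algorithm. *)
Lemma rank_perm d (T : orderType d) n (f : 'I_n -> T) :
  exists s : {perm 'I_n}, (forall i, rank f (s i) = i) /\
    (forall i j : 'I_n, (i <= j)%N -> (f (s i) <= f (s j))%O).
Proof.
have rinj : injective (fun i => Ordinal (rank_lt f i)).
  by move=> i j [/rank_inj].
exists (perm rinj)^-1%g; have rK i : rank f ((perm rinj)^-1%g i) = i.
  by rewrite -[RHS](congr1 val (permKV (perm rinj) i)) permE.
split=> // i j ij; rewrite leNgt; apply/negP => fji.
have : precedes f ((perm rinj)^-1%g j) ((perm rinj)^-1%g i).
  by rewrite /precedes (ltW fji) /= leNgt fji.
by move/ltn_rank; rewrite !rK ltnNge ij.
Qed.

(** Remove the job [l] that starts last: the others are completed by [S l], so their total length is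
    at most [S l], which bounds the cross term of the square. *)
Lemma single_machine_midpoints (R : realFieldType) (J : finType) (A : {set J})
    (S q : J -> R) :
  (forall j, 0 <= S j /\ 0 < q j) ->
  (forall i j, i \in A -> j \in A -> i != j ->
     S i + q i <= S j \/ S j + q j <= S i) ->
  (\sum_(j in A) q j) ^+ 2 <= 2 * \sum_(j in A) q j * (S j + q j / 2).
Proof.
(* The induction also carries that disjoint jobs completed by time [T] have total length at most
   [T]. *)
move=> Sq Hd; suff [] : (forall T : R, 0 <= T ->
    (forall j, j \in A -> S j + q j <= T) -> \sum_(j in A) q j <= T) /\
    (\sum_(j in A) q j) ^+ 2 <= 2 * \sum_(j in A) q j * (S j + q j / 2) by [].
elim: {A}#|A| {-2}A (erefl #|A|) Hd => [|k IH] A.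
  move=> /eqP; rewrite cards_eq0 => /eqP-> _.
  by split=> [T T0 _|]; rewrite !big_set0// expr0n mulr0.
move=> cA Hd; have /card_gt0P[i0 i0A] : (0 < #|A|)%N by rewrite cA.
have [l lA lmax] : exists2 l, l \in A & forall i, i \in A -> S i <= S l.
  by case: (arg_maxP S i0A) => l lA lmax; exists l.
have cAl : #|A :\ l| = k by move: cA; rewrite (cardsD1 l) lA => -[].
have Cl j : j \in A :\ l -> S j + q j <= S l.
  rewrite !inE => /andP[jl jA]; case: (Hd _ _ jA lA jl) => //.
  by have := lmax _ jA; have := Sq l; lra.
have HdAl i j : i \in A :\ l -> j \in A :\ l -> i != j ->
    S i + q i <= S j \/ S j + q j <= S i.
  by rewrite !inE => /andP[_ iA] /andP[_ jA]; exact: Hd.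
have {IH} [IH1 IH2] := IH _ cAl HdAl.
have Ql := IH1 _ (proj1 (Sq l)) Cl.
have DA (F : J -> R) : \sum_(j in A) F j = F l + \sum_(j in A :\ l) F j.
  by rewrite (big_setD1 l).
rewrite !DA; split; first by move=> T T0 /(_ _ lA); lra.
have := Sq l; nra.
Qed.

(** Cauchy-Schwarz with the all-ones vector, from expanding the sum of the squares of [m * L r - Q],
    where [Q] is the sum of the [L r]. *)
Lemma sum_sqr_le (R : realFieldType) (m : nat) (L : 'I_m -> R) :
  (\sum_r L r) ^+ 2 <= m%:R * \sum_r L r ^+ 2.
Proof.
case: m L => [|m] L; first by rewrite !big_ord0 expr0n mulr0.
set Q := \sum_r L r.
have : 0 <= \sum_r (m.+1%:R * L r - Q) ^+ 2 by apply: sumr_ge0 => r _; exact: sqr_ge0.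
have -> : \sum_r (m.+1%:R * L r - Q) ^+ 2
    = m.+1%:R * (m.+1%:R * \sum_r L r ^+ 2 - Q ^+ 2).
  transitivity (\sum_r (m.+1%:R ^+ 2 * L r ^+ 2 - 2 * m.+1%:R * Q * L r + Q ^+ 2)).
    by apply: eq_bigr => r _; ring.
  rewrite big_split sumrB /= -!mulr_sumr -/Q sumr_const card_ord -mulr_natl; ring.
by rewrite pmulr_rge0 ?ltr0n// subr_ge0.
Qed.

Section LowerBound.
Variables (R : realType) (alpha : R) (I : instance R).
Local Notation n := (njobs I).
Local Notation m := (nproc I).

Lemma sum_jsize (S : schedule I) (X : 'I_n -> R) (A : {set 'I_n}) :
  (forall j, #|procs S j| = jsize j) ->
  \sum_(j in A) (jsize j)%:R * X j
  = \sum_(r < m) \sum_(j in [set j in A | r \in procs S j]) X j.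
Proof.
move=> cS.
transitivity (\sum_(j in A) \sum_(r in procs S j) X j).
  by apply: eq_bigr => j _; rewrite sumr_const cS mulr_natl.
rewrite (exchange_big_dep predT)//=; apply: eq_bigr => r _.
by apply: eq_bigl => j; rewrite inE.
Qed.

Lemma area_midpoints (S : schedule I) (A : {set 'I_n}) :
  feasible alpha S ->
  (\sum_(j in A) (jsize j)%:R * duration S j) ^+ 2
  <= 2 * m%:R * \sum_(j in A) (jsize j)%:R * duration S j
                  * (start S j + duration S j / 2).
Proof.
move=> [S0 cS dS _].
rewrite [X in _ * X](eq_bigr (fun j => (jsize j)%:R *
  (duration S j * (start S j + duration S j / 2)))) => [|j _]; last by rewrite mulrA.
rewrite !(sum_jsize _ _ cS); apply: le_trans (sum_sqr_le _) _.
rewrite -mulrA mulrCA; apply: ler_wpM2l => //.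
rewrite mulr_sumr; apply: ler_sum => r _.
apply: single_machine_midpoints => // i j.
rewrite !inE => /andP[_ ri] /andP[_ rj] ij; apply: dS => //.
by apply/pred0Pn; exists r; rewrite /= ri rj.
Qed.

(** The permutation [t] sorts by the areas of the given schedule, hence depends on [S]. A completion
    time is a midpoint plus half a duration; this half gives the summand [(2 * size)^-1]. *)
Lemma total_completion_ge (S : schedule I) :
  (forall j : 'I_n, (0 < jsize j)%N) -> (0 < m)%N -> feasible alpha S ->
  exists t : {perm 'I_n},
  \sum_(i < n) (jsize (t i))%:R *
    (((n - i)%:R - 2^-1) / m%:R + (2 * (jsize (t i))%:R)^-1) * duration S (t i)
  <= total_completion S.
Proof.
move=> s0 m0 fS.
pose a j := (jsize j)%:R * duration S j : R.
have a0 j : 0 < a j by case: fS => /(_ j)[_ ?] _ _ _; rewrite mulr_gt0// ltr0n.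
have [t [_ tmono]] := rank_perm a; exists t.
pose b := of_fun 1 (a \o t).
pose M := of_fun 0 (fun i => start S (t i) + duration S (t i) / 2).
have bE i : b (val i) = a (t i) by rewrite /b /of_fun valK.
have ME i : M (val i) = start S (t i) + duration S (t i) / 2.
  by rewrite /M /of_fun valK.
have := @sum_of_prefix_squares R n m%:R b M.
rewrite ltr0n => /(_ m0) H.
have {}H : \sum_(i < n) ((n - i)%:R - 2^-1) * b i <= m%:R * \sum_(i < n) M i.
  apply: H => [i ltin|i j /andP[ij ltjn]|k kn].
  - by rewrite (bE (Ordinal ltin)).
  - by rewrite (bE (Ordinal (leq_ltn_trans ij ltjn))) (bE (Ordinal ltjn)) tmono.
  (* The area bound is applied to the first [k] jobs in the order [t]. *)
  - have := area_midpoints [set t i | i : 'I_n & (i < k)%N] fS.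
    have E (F : 'I_n -> R) (G : nat -> R) : (forall i : 'I_n, G i = F (t i)) ->
        \sum_(j in [set t i | i : 'I_n & (i < k)%N]) F j = \sum_(i < k) G i.
      move=> FG; rewrite big_imset => [|? ? _ _]; last exact: perm_inj.
      rewrite (big_ord_widen _ G kn); apply: eq_big => i; first by rewrite inE.
      by rewrite FG.
    rewrite (E _ b)// (E _ (fun i => b i * M i))// => i.
    by rewrite bE ME.
have -> : total_completion S = \sum_(i < n) M i + \sum_(i < n) duration S (t i) / 2.
  rewrite -big_split /= /total_completion (reindex_inj (@perm_inj _ t)).
  by apply: eq_bigr => i _; rewrite ME /completion; field.
move: H; rewrite -ler_pdivrMl ?ltr0n// => H.
apply: le_trans (lerD H (lexx _)); rewrite mulr_sumr -big_split.
apply: ler_sum => i _ /=; rewrite bE /a.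
rewrite le_eqVlt; apply/orP; left; apply/eqP.
have := s0 (t i); rewrite -(ltr0n R) => /lt0r_neq0.
have := m0; rewrite -(ltr0n R) => /lt0r_neq0.
by move=> ? ?; field; apply/andP.
Qed.

End LowerBound.

(** * The cyclic schedule *)

(** A weighted Young inequality, reduced to [addr_powR_ge] by [r = q * y^(1/alpha) / c]. Equality
    holds at [q = c / y^(1/alpha)], the form of the durations chosen by the algorithm. *)
Lemma young_scaled (R : realType) (alpha y q c : R) :
  1 < alpha -> 0 < y -> 0 < q -> 0 < c ->
  alpha * (c * (y / powR y alpha^-1))
  <= (alpha - 1) * (y * q) + powR (c / q) alpha * q.
Proof.
move=> a1 y0 q0 c0; have a0 : 0 < alpha by lra.
have v0 : 0 < powR y alpha^-1 := powR_gt0 _ y0.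
have vE : powR (powR y alpha^-1) alpha = y.
  by rewrite -powRrM mulVf ?gt_eqF// powRr1 // ltW.
set v := powR y alpha^-1 in v0 vE *.
pose r := q * v / c; have r0 : 0 < r by rewrite divr_gt0 ?mulr_gt0.
have ra0 : 0 < powR r alpha := powR_gt0 _ r0.
have -> : powR (c / q) alpha = y / powR r alpha.
  apply/(canRL (mulfK (lt0r_neq0 ra0))).
  rewrite -powRM ?(ltW r0)// ?divr_ge0 ?ltW//; rewrite -[RHS]vE; congr powR.
  by rewrite /r; field; rewrite !gt_eqF.
have -> : y / powR r alpha * q = c * (y / v) * (r / powR r alpha).
  by rewrite /r; field; rewrite !gt_eqF.
have -> : (alpha - 1) * (y * q) = c * (y / v) * ((alpha - 1) * r).
  by rewrite /r; field; rewrite !gt_eqF.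
rewrite mulrC -mulrDr; apply: ler_wpM2l; last exact: addr_powR_ge.
by rewrite mulr_ge0 ?divr_ge0 ?ltW.
Qed.

Lemma card_ord_interval (m lo hi : nat) : (hi <= m)%N ->
  #|[set r : 'I_m | (lo <= r < hi)%N]| = (hi - lo)%N.
Proof.
move=> him; rewrite -sum1_card -[RHS]muln1 -sum_nat_const_nat.
rewrite (big_nat_widen _ _ _ _ _ him) big_geq_mkord.
by apply: eq_bigl => r; rewrite inE andbC.
Qed.

Section CyclicSchedule.
Variables (R : realType) (alpha : R) (I : instance R).
Local Notation n := (njobs I).
Local Notation m := (nproc I).
Variable sigma : {perm 'I_n}.

(** Total on the naturals with default 0, so that [2 * size <= m] holds at every index. *)
Definition sorted_size (i : nat) : nat := of_fun 0%N (fun j => jsize (sigma j)) i.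
Definition offset (i : nat) : nat := \sum_(l < i) sorted_size l.
(* The lower bound on the total completion time is the sum over positions i of
   size_i * density_i * p_i; subject to the energy budget it is minimal when
   the speed of the i-th job is proportional to density_i^(1/alpha). *)
Definition density (i : nat) : R :=
  ((n - i)%:R - 2^-1) / m%:R + (2 * (sorted_size i)%:R)^-1.
Definition rel_speed (i : nat) : R := powR (density i) alpha^-1.
Definition total_weight : R :=
  \sum_(i < n) (sorted_size i)%:R * (density i / rel_speed i).
(** The constant for which the durations [scale W / rel_speed i] exhaust the budget exactly;
    [scale W * total_weight] is the value of the linear lower bound at these durations. *)
Definition scale (W : R) : R :=
  powR (powR W alpha * total_weight / budget I) (alpha - 1)^-1.

(* Laid end to end, job i occupies the positions offset i, ..., offset i.+1 - 1
   of an infinite line that is wrapped around the m processors. *)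
Definition cyclic_procs (i : nat) : {set 'I_m} :=
  [set r : 'I_m | (offset i %% m <= r < offset i %% m + sorted_size i)%N
                  || (r < offset i %% m + sorted_size i - m)%N].

(** Every earlier job [k] sharing a processor with job [i] passes this test, which compares offsets
    without reducing them modulo [m]. Jobs several turns back pass it as well. *)
Definition blocks (k i : nat) : bool := (offset k + m < offset i.+1)%N.

(** Specifies a running maximum, started at 0. The bound [k0] is separate from [i] so that it can
    follow the inner loop of the program. *)
Definition earliest_start (x : R) (completion : 'I_n -> R) (i k0 : nat) : Prop :=
  [/\ 0 <= x,
      forall k : 'I_n, (k < k0)%N -> blocks k i -> completion k <= x
    & x = 0 \/
      exists k : 'I_n, [/\ (k < k0)%N, blocks k i & x = completion k]].

Lemma sorted_sizeE (i : 'I_n) : sorted_size i = jsize (sigma i).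
Proof. by rewrite /sorted_size /of_fun valK. Qed.

Lemma offsetS i : offset i.+1 = (offset i + sorted_size i)%N.
Proof. by rewrite /offset big_ord_recr. Qed.

Lemma leq_offset i j : (i <= j)%N -> (offset i <= offset j)%N.
Proof.
move=> /subnK <-; elim: (j - i)%N => // k IH; rewrite addSn offsetS.
exact: leq_trans IH (leq_addr _ _).
Qed.

Hypothesis alpha_gt1 : 1 < alpha.
Hypothesis jsize_gt0 : forall j : 'I_n, (0 < jsize j)%N.
Hypothesis jsize_half : forall j : 'I_n, (2 * jsize j <= m)%N.
Hypothesis budget_gt0 : 0 < budget I.
Variable W : R.
Hypothesis W_gt0 : 0 < W.
Hypothesis workE : forall j : 'I_n, work j = W.
Hypothesis sigma_sorted :
  forall i j : 'I_n, (i <= j)%N -> (jsize (sigma i) <= jsize (sigma j))%N.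

(** * Monotonicity of the durations and the lower bound under the energy budget *)

Lemma alpha_gt0 : 0 < alpha.
Proof. exact: lt_trans ltr01 alpha_gt1. Qed.

Lemma sorted_size_gt0 i : (i < n)%N -> (0 < sorted_size i)%N.
Proof. by move=> ltin; rewrite (sorted_sizeE (Ordinal ltin)). Qed.

Lemma sorted_size_half i : (2 * sorted_size i <= m)%N.
Proof. by rewrite /sorted_size /of_fun; case: insubP => //= j _ _. Qed.

Lemma leq_sorted_size i j :
  (i <= j)%N -> (j < n)%N -> (sorted_size i <= sorted_size j)%N.
Proof.
move=> ij ltjn; have ltin := leq_ltn_trans ij ltjn.
by rewrite (sorted_sizeE (Ordinal ltin)) (sorted_sizeE (Ordinal ltjn)) sigma_sorted.
Qed.

Lemma nproc_gt0 i : (i < n)%N -> (0 < m)%N.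
Proof. move=> /sorted_size_gt0; have := sorted_size_half i; lia. Qed.

Lemma position_weight_ge0 i : (i < n)%N -> (0 : R) <= (n - i)%:R - 2^-1.
Proof.
move=> ltin; have : (1 : R) <= (n - i)%:R by rewrite ler1n subn_gt0.
lra.
Qed.

Lemma density_gt0 i : (i < n)%N -> 0 < density i.
Proof.
move=> ltin; apply: ltr_wpDl.
  by rewrite divr_ge0 ?position_weight_ge0.
by rewrite invr_gt0 mulr_gt0// ltr0n sorted_size_gt0.
Qed.

Lemma rel_speed_gt0 i : (i < n)%N -> 0 < rel_speed i.
Proof. by move=> ltin; rewrite powR_gt0// density_gt0. Qed.

Lemma rel_speedK i : (i < n)%N -> powR (rel_speed i) alpha = density i.
Proof.
move=> ltin; rewrite -powRrM mulVf ?powRr1 ?ltW ?density_gt0// gt_eqF//.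
exact: alpha_gt0.
Qed.

Lemma le_position_weight i j : (i <= j)%N ->
  ((n - j)%:R - 2^-1 : R) <= (n - i)%:R - 2^-1.
Proof. by move=> ij; rewrite lerD2r ler_nat leq_sub2l. Qed.

(** Neither summand of [density] increases along the order: position weights decrease and sizes do
    not. The durations are therefore nondecreasing. *)
Lemma le_rel_speed i j : (i <= j)%N -> (j < n)%N -> rel_speed j <= rel_speed i.
Proof.
move=> ij ltjn; have ltin := leq_ltn_trans ij ltjn.
apply: ge0_ler_powR; rewrite ?nnegrE ?(ltW (density_gt0 _))//.
  by rewrite invr_ge0 ltW// alpha_gt0.
apply: lerD.
  by rewrite ler_wpM2r ?invr_ge0// le_position_weight.
have ? := sorted_size_gt0 ltin; have ? := sorted_size_gt0 ltjn.
rewrite lef_pV2 ?posrE ?mulr_gt0 ?ltr0n// ler_wpM2l//.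
by rewrite ler_nat leq_sorted_size.
Qed.

Lemma total_weight_gt0 i : (i < n)%N -> 0 < total_weight.
Proof.
move=> ltin; have t0 (j : 'I_n) :
    0 < (sorted_size j)%:R * (density j / rel_speed j) :> R.
  by rewrite mulr_gt0 ?divr_gt0 ?density_gt0 ?rel_speed_gt0// ltr0n sorted_size_gt0.
rewrite /total_weight (bigD1 (Ordinal ltin))//=; apply: ltr_pwDl.
  exact: (t0 (Ordinal ltin)).
by apply: sumr_ge0 => j _; exact: ltW.
Qed.

Lemma scale_gt0 i : (i < n)%N -> 0 < scale W.
Proof.
move=> ltin; rewrite powR_gt0// divr_gt0// mulr_gt0 ?powR_gt0//.
exact: total_weight_gt0 ltin.
Qed.

(** The definition of [scale] solved for the power [alpha - 1]. It converts powers of the scale into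
    energies, with multiplier [scale W * total_weight / budget I]. *)
Lemma scaleK i : (i < n)%N ->
  powR (scale W) alpha = scale W * total_weight / budget I * powR W alpha.
Proof.
move=> ltin; have c0 := scale_gt0 ltin.
have -> : powR (scale W) alpha = scale W * powR (scale W) (alpha - 1).
  by rewrite mulr_powRB1 ?ltW// alpha_gt0.
rewrite {2}/scale -powRrM mulVf; last by rewrite gt_eqF// subr_gt0.
have := powR_gt0 alpha W_gt0; have := total_weight_gt0 ltin => F0 W0.
rewrite powRr1; first by field; rewrite gt_eqF.
by rewrite ltW// divr_gt0// mulr_gt0.
Qed.

(** With [gamma = 1 - 1/alpha] in [0, 1], a term is [size * z^gamma]. Moving to an earlier position
    raises [z] equally for all sizes; a larger size has a smaller [z], so by concavity its power
    grows more, and the factor [size] is larger too. This is the Monge condition of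
    [rearrangement]. *)
Lemma total_weight_min (t : {perm 'I_n}) :
  total_weight <= \sum_(i < n) (jsize (t i))%:R *
    let y := ((n - i)%:R - 2^-1) / m%:R + (2 * (jsize (t i))%:R)^-1 in
    y / powR y alpha^-1.
Proof.
pose gamma := 1 - alpha^-1.
pose G l i : R := (sorted_size l)%:R *
  powR (((n - i)%:R - 2^-1) / m%:R + (2 * (sorted_size l)%:R)^-1) gamma.
have z_gt0 l i : (l < n)%N -> (i < n)%N -> 
    0 < ((n - i)%:R - 2^-1) / m%:R + (2 * (sorted_size l)%:R)^-1 :> R.
  move=> lln lin; apply: ltr_wpDl; first by rewrite divr_ge0 ?position_weight_ge0.
  by rewrite invr_gt0 mulr_gt0// ltr0n sorted_size_gt0.
have powE (y : R) : 0 < y -> y / powR y alpha^-1 = powR y gamma.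
  move=> y0; rewrite /gamma powRB ?(gt_eqF y0) ?implybT//.
  by rewrite powRr1 ?ltW.
have a1 := alpha_gt1; have a0 := alpha_gt0.
have gamma01 : 0 <= gamma <= 1.
  rewrite /gamma; have : 0 < alpha^-1 by rewrite invr_gt0; lra.
  have : alpha^-1 <= 1 by rewrite invf_le1; lra.
  lra.
have -> : total_weight = \sum_(i < n) G i i.
  by apply: eq_bigr => i _; rewrite /G /rel_speed powE ?density_gt0.
(* Position [i] holds job [t i], whose index in the sorted order is [sigma^-1 (t i)]. *)
set rhs := (X in _ <= X); have -> : rhs = \sum_(i < n) G ((t * sigma^-1)%g i) i.
  apply: eq_bigr => i _ /=; have := z_gt0 ((t * sigma^-1)%g i) i (ltn_ord _) (ltn_ord _).
  by rewrite /G sorted_sizeE permM permKV => z0; rewrite powE.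
apply: rearrangement => l i j ltl /andP[ij ltj].
have ltin := leq_ltn_trans ij ltj; have ltl' := ltnW ltl.
have s1 := leq_sorted_size (leqnSn l) ltl.
have s0 := sorted_size_gt0 ltl'.
rewrite /G; set s := sorted_size l in s0 s1 *; set s' := sorted_size l.+1 in s1 *.
have s0' := leq_trans s0 s1.
pose d : R := ((n - i)%:R - 2^-1) / m%:R - ((n - j)%:R - 2^-1) / m%:R.
have d0 : 0 <= d by rewrite /d -mulrBl divr_ge0// subr_ge0 le_position_weight.
have zz' : ((n - j)%:R - 2^-1) / m%:R + (2 * s'%:R)^-1
    <= ((n - j)%:R - 2^-1) / m%:R + (2 * s%:R)^-1 :> R.
  by rewrite lerD2l lef_pV2 ?posrE ?mulr_gt0 ?ltr0n// ler_wpM2l// ler_nat.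
have := powR_increment gamma01 (z_gt0 _ _ ltl ltj) zz' d0.
have -> : ((n - j)%:R - 2^-1) / m%:R + (2 * s%:R)^-1 + d
  = ((n - i)%:R - 2^-1) / m%:R + (2 * s%:R)^-1 by rewrite /d; ring.
have -> : ((n - j)%:R - 2^-1) / m%:R + (2 * s'%:R)^-1 + d
  = ((n - i)%:R - 2^-1) / m%:R + (2 * s'%:R)^-1 by rewrite /d; ring.
have : powR (((n - j)%:R - 2^-1) / m%:R + (2 * s%:R)^-1) gamma
    <= powR (((n - i)%:R - 2^-1) / m%:R + (2 * s%:R)^-1) gamma.
  have [g0 _] := andP gamma01.
  apply: ge0_ler_powR; rewrite ?nnegrE ?(ltW (z_gt0 _ _ _ _))//.
  by rewrite lerD2r ler_wpM2r ?invr_ge0// le_position_weight.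
set p1 := powR _ _; set p2 := powR _ _; set p3 := powR _ _; set p4 := powR _ _.
move=> H1 H2; have ss : s%:R <= s'%:R :> R by rewrite ler_nat.
have s0R : 0 < s%:R :> R by rewrite ltr0n.
nra.
Qed.

(** Lagrangian duality: by [young_scaled], [alpha - 1] times the linear lower bound plus
    [scale W * total_weight / budget I] times the energy is at least
    [alpha * scale W * total_weight], and the budget caps the energy term by
    [scale W * total_weight]. *)
Lemma total_completion_lower (S : schedule I) :
  feasible alpha S -> scale W * total_weight <= total_completion S.
Proof.
move=> fS; case: (posnP n) => [n0|n_gt0].
  have no (i : 'I_n) : False by have := leq_ltn_trans (leq0n i) (ltn_ord i); rewrite n0.
  by rewrite /total_weight /total_completion !big1 ?mulr0// => i; case: (no i).
have c0 := scale_gt0 n_gt0; have F0 := total_weight_gt0 n_gt0.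
have a0 := alpha_gt0; have [t] := total_completion_ge jsize_gt0 (nproc_gt0 n_gt0) fS.
apply: le_trans; have [_ _ _ eS] := fS.
have q0 j : 0 < duration S j by case: fS => /(_ j)[].
set y := fun i : 'I_n => ((n - i)%:R - 2^-1) / m%:R + (2 * (jsize (t i))%:R)^-1 : R.
have y0 i : 0 < y i.
  apply: ltr_wpDl; first by rewrite divr_ge0 ?position_weight_ge0.
  by rewrite invr_gt0 mulr_gt0// ltr0n.
have a1 : 0 < alpha - 1 by rewrite subr_gt0.
rewrite -(ler_pM2l a1) mulrBl mul1r lerBlDr.
apply: (@le_trans _ _ (\sum_(i < n) (jsize (t i))%:R *
    (alpha * (scale W * (y i / powR (y i) alpha^-1))))).
  rewrite (eq_bigr (fun i => alpha * (scale W *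
    ((jsize (t i))%:R * (y i / powR (y i) alpha^-1))))); last by move=> i _; ring.
  rewrite -!mulr_sumr; apply: ler_wpM2l; first by lra.
  by rewrite ler_wpM2l ?(ltW c0)// total_weight_min.
apply: (@le_trans _ _ (\sum_(i < n) (jsize (t i))%:R *
    ((alpha - 1) * (y i * duration S (t i))
     + powR (scale W / duration S (t i)) alpha * duration S (t i)))).
  apply: ler_sum => i _; apply: ler_wpM2l => //; exact: young_scaled.
rewrite (eq_bigr (fun i => (alpha - 1) * ((jsize (t i))%:R * y i * duration S (t i))
   + scale W * total_weight / budget I * job_energy alpha S (t i))); last first.
  move=> i _; rewrite /job_energy /speed workE.
  rewrite !powRM ?invr_ge0 ?ltW// (scaleK n_gt0); ring.
rewrite big_split -!mulr_sumr /= lerD2l.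
have -> : \sum_(i < n) job_energy alpha S (t i) = energy alpha S.
  by rewrite /energy [RHS](reindex_inj (@perm_inj _ t)).
rewrite -[leRHS](divfK (lt0r_neq0 budget_gt0)); apply: ler_wpM2l => //.
by rewrite divr_ge0 ?mulr_ge0 ?ltW.
Qed.

(** Lifts a processor to a point of the unwrapped line: [a] is the turn in which job [i] begins, or
    the next one for the wrapped part. *)
Lemma cyclic_position i (r : 'I_m) : r \in cyclic_procs i ->
  exists2 a, (offset i <= a * m + r)%N & (a * m + r < offset i.+1)%N.
Proof.
have s1 := sorted_size_half i.
rewrite inE offsetS; have := ltn_ord r; have := divn_eq (offset i) m.
set Q := (offset i %/ m)%N; set P := (offset i %% m)%N => oE rm /orP[/andP[]|] ? .
  move=> ?; exists Q; lia.
by exists Q.+1; rewrite ?mulSn; lia.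
Qed.

(** The lifts of [r] for the two jobs lie in different turns, hence at least [m] apart. *)
Lemma cyclic_conflict i k (r : 'I_m) :
  (k < i)%N -> r \in cyclic_procs k -> r \in cyclic_procs i -> blocks k i.
Proof.
move=> ki /cyclic_position[a a1 a2] /cyclic_position[b b1 b2].
have le := leq_offset ki; rewrite /blocks.
have ab : (a < b)%N.
  rewrite ltnNge; apply/negP => ba; have := leq_mul ba (leqnn m); lia.
have := leq_mul ab (leqnn m); rewrite mulSn; lia.
Qed.

Lemma card_cyclic_procs i : (i < n)%N -> #|cyclic_procs i| = sorted_size i.
Proof.
move=> ltin; have m0 := nproc_gt0 ltin; have s1 := sorted_size_half i.
have Pm := ltn_pmod (offset i) m0.
rewrite /cyclic_procs; set P := (offset i %% m)%N in Pm *; set s := sorted_size i in s1 *.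
have -> : [set r : 'I_m | (P <= r < P + s)%N || (r < P + s - m)%N]
  = [set r : 'I_m | (P <= r < minn m (P + s))%N] :|: [set r : 'I_m | (0 <= r < P + s - m)%N].
  apply/setP => r; rewrite !inE leq0n /=; have := ltn_ord r; lia.
rewrite cardsU !card_ord_interval; try lia.
set B := _ :&: _; have -> : B = finset.set0.
  apply/setP => r; rewrite !inE; have := ltn_ord r; lia.
rewrite cards0; lia.
Qed.

Lemma cyclic_approx (S : schedule I) :
  (forall i : 'I_n, duration S (sigma i) = scale W / rel_speed i) ->
  (forall i : 'I_n, procs S (sigma i) = cyclic_procs i) ->
  (forall i : 'I_n, earliest_start (start S (sigma i))
                      (fun k => completion S (sigma k)) i i) ->
  approx_schedule alpha 2 S.
Proof.
move=> durE procsE startE.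
pose st := of_fun 0 (start S \o sigma); pose p i := scale W / rel_speed i.
have stE (i : 'I_n) : st i = start S (sigma i) by rewrite /st /of_fun valK.
have cE (i : 'I_n) : completion S (sigma i) = st i + p i.
  by rewrite stE /completion durE.
have p0 i : (i < n)%N -> 0 < p i.
  by move=> ltin; rewrite divr_gt0 ?rel_speed_gt0 ?(scale_gt0 ltin).
have startP i : (i < n)%N -> [/\ 0 <= st i,
    forall k, (k < i)%N -> blocks k i -> st k + p k <= st i &
    st i = 0 \/ exists k, [/\ (k < i)%N, blocks k i & st i = st k + p k]].
  move=> ltin; have [] := startE (Ordinal ltin); rewrite -stE => H1 H2 H3.
  split=> //= [k ki bki|].
    by have := H2 (Ordinal (ltn_trans ki ltin)) ki bki; rewrite cE.
  by case: H3 => [|[k [ki bki]]]; [left | rewrite cE; right; exists k].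
have [s sK Ks] : bijective sigma by exists (sigma^-1)%g; [exact: permK|exact: permKV].
have fS : feasible alpha S.
  split.
  - move=> j; rewrite -(Ks j) durE -stE; split; last exact: p0.
    by case: (startP (s j) (ltn_ord _)).
  - by move=> j; rewrite -(Ks j) procsE card_cyclic_procs// sorted_sizeE.
  - have conflict (i k : 'I_n) (r : 'I_m) : (k < i)%N -> r \in procs S (sigma k) ->
        r \in procs S (sigma i) -> completion S (sigma k) <= start S (sigma i).
      rewrite !procsE => ki rk ri; have [_ H _] := startP i (ltn_ord _).
      by rewrite /completion durE -!stE H// (cyclic_conflict ki rk ri).
    move=> i j; rewrite -(Ks i) -(Ks j) => ij /pred0Pn[r /andP[ri rj]].
    have : s i != s j by apply: contra ij => /eqP->.
    rewrite -val_eqE /= neq_ltn => /orP[lt|lt]; [left|right].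
      exact: conflict lt ri rj.
    exact: conflict lt rj ri.
  - case: (posnP n) => [n0|n_gt0].
      rewrite /energy big1 ?(ltW budget_gt0)// => i.
      by have := leq_ltn_trans (leq0n i) (ltn_ord i); rewrite n0.
    have c0 := scale_gt0 n_gt0; have F0 := total_weight_gt0 n_gt0.
    rewrite /energy (reindex_inj (@perm_inj _ sigma)) /=.
    (* Each job consumes a share of the budget proportional to its term in [total_weight]. *)
    rewrite (eq_bigr (fun i : 'I_n => budget I / total_weight *
        ((sorted_size i)%:R * (density i / rel_speed i)))); last first.
      move=> i _; have v0 := rel_speed_gt0 (ltn_ord i).
      rewrite /job_energy /speed durE workE sorted_sizeE.
      have -> : powR (W / (scale W / rel_speed i)) alpha
          = density i * budget I / (scale W * total_weight).
        have -> : W / (scale W / rel_speed i) = W * rel_speed i * (scale W)^-1.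
          by field; rewrite !gt_eqF.
        have W0 := powR_gt0 alpha W_gt0.
        have ca0 := powR_gt0 alpha c0.
        rewrite !powRM ?mulr_ge0 ?invr_ge0 ?ltW// rel_speedK//.
        have -> : powR (scale W)^-1 alpha = (powR (scale W) alpha)^-1.
          rewrite -[RHS]mul1r; apply/(canRL (mulfK (lt0r_neq0 ca0))).
          by rewrite -powRM ?invr_ge0 ?ltW// mulVf ?powR1// gt_eqF.
        by rewrite (scaleK n_gt0); field; rewrite !gt_eqF.
      by field; rewrite !gt_eqF.
    by rewrite -mulr_sumr -/total_weight divfK// gt_eqF.
have start_le i : (i < n)%N ->
    m%:R * st i <= 2 * \sum_(l < i) (sorted_size l)%:R * p l.
  elim/ltn_ind: i => i IH ltin.
  have a0 k : (k < n)%N -> 0 <= (sorted_size k)%:R * p k.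
    by move=> ltk; rewrite mulr_ge0// ltW// p0.
  have [_ _ []] := startP i ltin => [->|[k [ki bki ->]]].
    rewrite mulr0 mulr_ge0// sumr_ge0// => l _; apply: a0.
    exact: ltn_trans (ltn_ord l) ltin.
  have ltkn := ltn_trans ki ltin; have := IH k ki ltkn.
  have -> : \sum_(l < i) (sorted_size l)%:R * p l
     = \sum_(l < k) (sorted_size l)%:R * p l
       + \sum_(k <= l < i) (sorted_size l)%:R * p l.
    rewrite -(big_mkord xpredT (fun l => (sorted_size l)%:R * p l)).
    by rewrite (big_cat_nat (leq0n k) (ltnW ki)) big_mkord.
  have : p k * (offset i - offset k)%:R
      <= \sum_(k <= l < i) (sorted_size l)%:R * p l.
    have -> : (offset i - offset k)%N = (\sum_(k <= l < i) sorted_size l)%N.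
      rewrite /offset -!(big_mkord xpredT sorted_size).
      by rewrite (big_cat_nat (leq0n k) (ltnW ki)) addKn.
    rewrite natr_sum mulr_sumr big_nat [leRHS]big_nat; apply: ler_sum => l /andP[kl li].
    rewrite mulrC ler_wpM2l// ler_wpM2l ?(ltW (scale_gt0 ltin))//.
    have ltln := ltn_trans li ltin.
    by rewrite lef_pV2 ?posrE ?rel_speed_gt0// le_rel_speed.
  (* The blocking test gives [offset i - offset k > m - size_i], and [size_i <= m / 2]. *)
  have : m%:R <= 2 * (offset i - offset k)%:R :> R.
    rewrite -natrM ler_nat; move: bki; rewrite /blocks offsetS.
    have := sorted_size_half i; lia.
  have := p0 k ltkn.
  set z := (_ - _)%:R; set X := \sum_(_ <= _ < _) _; set Y := \sum_(_ < _) _.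
  nra.
split=> //.
have up : total_completion S <= 2 * (scale W * total_weight).
  case: (posnP n) => [n0|n_gt0].
    have no (i : 'I_n) : False by have := leq_ltn_trans (leq0n i) (ltn_ord i); rewrite n0.
    by rewrite /total_weight /total_completion !big1 ?mulr0// => i; case: (no i).
  have m0 : 0 < m%:R :> R by rewrite ltr0n (nproc_gt0 n_gt0).
  pose a l := (sorted_size l)%:R * p l.
  (* Written with prefix areas, twice the lower bound dominates the completion times term by
     term. *)
  have -> : scale W * total_weight =
      \sum_(i < n) ((\sum_(l < i) a l + a i / 2) / m%:R + p i / 2).
    rewrite big_split -mulr_suml sum_suffix_weights mulr_suml -big_split /=.
    rewrite mulr_sumr; apply: eq_bigr => i _; rewrite /a /p {1}/density.
    have v0 := rel_speed_gt0 (ltn_ord i).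
    have s0 : 0 < (sorted_size i)%:R :> R by rewrite ltr0n sorted_size_gt0.
    by field; rewrite !gt_eqF.
  rewrite /total_completion (reindex_inj (@perm_inj _ sigma)) mulr_sumr /=.
  apply: ler_sum => i _; rewrite /completion -stE durE -/(p i).
  have := start_le i (ltn_ord i); rewrite -ler_pdivlMl// -/a.
  have : 0 <= a i by rewrite mulr_ge0// ltW// p0.
  have mV0 : 0 < m%:R^-1 :> R by rewrite invr_gt0.
  set Y := \sum_(_ < _) _; nra.
apply: le_trans up _; apply: ler_wpM2l => //.
(* A lower bound passes to the infimum of a nonempty set; [S] itself is a member. *)
apply: lb_le_inf; first by exists (total_completion S), S.
by move=> _ [S' fS' <-]; exact: total_completion_lower.
Qed.

End CyclicSchedule.

(** * Reasoning about programs *)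

Fixpoint nwrites (c : cmd) : seq nat :=
  match c with
  | Cskip | Crset _ _ _ => [::]
  | Cnset a _ _ => [:: a]
  | Cseq c1 c2 | Cif _ c1 c2 => nwrites c1 ++ nwrites c2
  | Cwhile _ c1 => nwrites c1
  end.

Fixpoint rwrites (c : cmd) : seq nat :=
  match c with
  | Cskip | Cnset _ _ _ => [::]
  | Crset a _ _ => [:: a]
  | Cseq c1 c2 | Cif _ c1 c2 => rwrites c1 ++ rwrites c2
  | Cwhile _ c1 => rwrites c1
  end.

(** The frame property, tracked for whole arrays by syntactic write sets. *)
Definition agree (R : realType) (c : cmd) (s s' : state R) : Prop :=
  (forall a, a \notin nwrites c -> nmem s' a = nmem s a) /\
  (forall a, a \notin rwrites c -> rmem s' a = rmem s a).

Lemma upd_other (T : Type) (f : nat -> nat -> T) a i v a' :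
  a' != a -> upd f a i v a' = f a'.
Proof. by move=> /negbTE ne; rewrite /upd ne. Qed.

Lemma exec_agree (R : realType) (alpha : R) c s t s' :
  exec alpha c s t s' -> agree c s s'.
Proof.
have trans c1 c2 c3 (s1 s2 s3 : state R) : agree c1 s1 s2 -> agree c2 s2 s3 ->
    {subset nwrites c1 <= nwrites c3} -> {subset nwrites c2 <= nwrites c3} ->
    {subset rwrites c1 <= rwrites c3} -> {subset rwrites c2 <= rwrites c3} ->
    agree c3 s1 s3.
  move=> [n1 r1] [n2 r2] sn1 sn2 sr1 sr2; split=> a na.
    by rewrite n2 ?n1//; apply: contra na; [exact: sn1 | exact: sn2].
  by rewrite r2 ?r1//; apply: contra na; [exact: sr1 | exact: sr2].
elim=> {c s t s'}; rewrite /agree /=.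
- by [].
- by move=> s a i e; split=> // a'; rewrite inE => ne /=; rewrite upd_other.
- by move=> s a i e; split=> // a'; rewrite inE => ne /=; rewrite upd_other.
- move=> c1 c2 s1 s2 s3 t1 t2 _ A1 _ A2.
  by apply: (trans c1 c2 (Cseq c1 c2)) A1 A2 _ _ _ _ => a /=;
    rewrite mem_cat => ->; rewrite ?orbT.
- move=> b c1 c2 s s' t _ [H1 H2]; split=> a; rewrite mem_cat negb_or => /andP[a1 a2].
    by apply: H1; case: ifP.
  by apply: H2; case: ifP.
- by [].
- move=> b c s1 s2 s3 t1 t2 _ _ A1 _ A2.
  by apply: (trans c (Cwhile b c) (Cwhile b c)) A1 A2 _ _ _ _.
Qed.

Definition wp (R : realType) (alpha : R) (c : cmd) (s : state R) (T : nat)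
    (Q : state R -> Prop) : Prop :=
  exists t s', [/\ exec alpha c s t s', (t <= T)%N & Q s'].

Section Wp.
Variables (R : realType) (alpha : R).
Implicit Types (s : state R) (Q : state R -> Prop).

(** The consequence rule. The new postcondition may use the frame of [c], so that invariants need
    only mention arrays that [c] writes. *)
Lemma wp_mono c s T T' Q Q' :
  (T <= T')%N -> (forall s', agree c s s' -> Q s' -> Q' s') ->
  wp alpha c s T Q -> wp alpha c s T' Q'.
Proof.
move=> TT QQ [t [s' [E tT q]]]; exists t, s'; split=> //.
  exact: leq_trans TT.
exact: QQ (exec_agree E) q.
Qed.

Lemma wp_skip s Q : Q s -> wp alpha Cskip s 1 Q.
Proof. by exists 1%N, s; split=> //; constructor. Qed.

Lemma wp_nset s a i e Q :
  Q (State (upd (nmem s) a (neval s i) (neval s e)) (rmem s)) ->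
  wp alpha (Cnset a i e) s 1 Q.
Proof. by move=> q; eexists 1%N, _; split; [constructor| |exact: q]. Qed.

Lemma wp_rset s a i e Q :
  Q (State (nmem s) (upd (rmem s) a (neval s i) (reval alpha s e))) ->
  wp alpha (Crset a i e) s 1 Q.
Proof. by move=> q; eexists 1%N, _; split; [constructor| |exact: q]. Qed.

Lemma wp_seq c1 c2 s T1 T2 Q1 Q :
  wp alpha c1 s T1 Q1 ->
  (forall s1, agree c1 s s1 -> Q1 s1 -> wp alpha c2 s1 T2 Q) ->
  wp alpha (Cseq c1 c2) s (T1 + T2) Q.
Proof.
move=> [t1 [s1 [E1 t1T q1]]] /(_ s1 (exec_agree E1) q1) [t2 [s2 [E2 t2T q2]]].
by exists (t1 + t2)%N, s2; split=> //; [econstructor; eassumption | exact: leq_add].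
Qed.

Lemma wp_seqn s a i e c T Q :
  wp alpha c (State (upd (nmem s) a (neval s i) (neval s e)) (rmem s)) T Q ->
  wp alpha (Cseq (Cnset a i e) c) s T.+1 Q.
Proof.
move=> [t [s' [E tT q]]]; exists t.+1, s'; split=> //.
by rewrite -add1n; apply: exec_seq E; constructor.
Qed.

Lemma wp_seqr s a i e c T Q :
  wp alpha c (State (nmem s) (upd (rmem s) a (neval s i) (reval alpha s e))) T Q ->
  wp alpha (Cseq (Crset a i e) c) s T.+1 Q.
Proof.
move=> [t [s' [E tT q]]]; exists t.+1, s'; split=> //.
by rewrite -add1n; apply: exec_seq E; constructor.
Qed.

Lemma wp_if b c1 c2 s T Q :
  wp alpha (if beval alpha s b then c1 else c2) s T Q ->
  wp alpha (Cif b c1 c2) s T.+1 Q.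
Proof. by move=> [t [s' [E tT q]]]; exists t.+1, s'; split=> //; constructor. Qed.

End Wp.

Definition nvar (a : nat) : nexp := Nget a (Nconst 0).
Definition nsucc (e : nexp) : nexp := Nadd e (Nconst 1).
Definition rsub (e1 e2 : rexp) : rexp := Radd e1 (Ropp e2).
Definition rdiv (e1 e2 : rexp) : rexp := Rmul e1 (Rinv e2).

Definition for_loop (a : nat) (e : nexp) (body : cmd) : cmd :=
  Cseq (Cnset a (Nconst 0) (Nconst 0))
    (Cwhile (Bnle (nsucc (nvar a)) e)
       (Cseq body (Cnset a (Nconst 0) (nsucc (nvar a))))).

Lemma agree_trans (R : realType) c (s1 s2 s3 : state R) :
  agree c s1 s2 -> agree c s2 s3 -> agree c s1 s3.
Proof. by move=> [n1 r1] [n2 r2]; split=> a na; rewrite ?n2 ?n1 ?r2 ?r1. Qed.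

(** [Inv i] is asserted with the counter already holding [i]. A round costs a test and an increment
    besides the body; the final 2 are the initialization and the last test. *)
Lemma wp_for (R : realType) (alpha : R) a e body N T (Inv : nat -> state R -> Prop) s0 :
  a \notin nwrites body ->
  (forall s, agree (for_loop a e body) s0 s -> neval s e = N) ->
  Inv 0%N (State (upd (nmem s0) a 0 0)%N (rmem s0)) ->
  (forall i s, (i < N)%N -> agree (for_loop a e body) s0 s -> nmem s a 0%N = i ->
     Inv i s -> wp alpha body s T
       (fun s' => Inv i.+1 (State (upd (nmem s') a 0 i.+1)%N (rmem s')))) ->
  wp alpha (for_loop a e body) s0 (N * (T + 2) + 2) (Inv N).
Proof.
move=> na eN I0 Istep; set c := for_loop a e body in eN Istep *.
have sub s s' : agree (Cwhile (Bnle (nsucc (nvar a)) e)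
       (Cseq body (Cnset a (Nconst 0) (nsucc (nvar a))))) s s' -> agree c s s'.
  move=> [H1 H2]; split=> b nb; last exact: H2.
  by apply: H1; move: nb; rewrite /= !inE negb_or => /andP[].
suff loop k i s : (i + k = N)%N -> agree c s0 s -> nmem s a 0%N = i -> Inv i s ->
    wp alpha (Cwhile (Bnle (nsucc (nvar a)) e)
       (Cseq body (Cnset a (Nconst 0) (nsucc (nvar a))))) s (k * (T + 2) + 1) (Inv N).
  rewrite -addn1 addnA addn1; apply: wp_seqn => /=; apply: (loop _ 0%N) => //.
    split=> b nb //=; rewrite upd_other//; apply: contra nb => /eqP->.
    exact: mem_head.
  by rewrite /= /upd !eqxx.
elim: k i s => [|k IH] i s ik As si Is.
  exists 1%N, s; split=> //; last by move: ik; rewrite addn0 => <-.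
  by apply: exec_while_stop; rewrite /= (eN _ As) si -ik; lia.
have ltiN : (i < N)%N by rewrite -ik; lia.
have [t [s1 [E1 t1 I1]]] := Istep i s ltiN As si Is.
set s2 := State _ _ in I1.
have s1i : nmem s1 a 0%N = i.
  by have [-> //] := exec_agree E1.
have E2 : exec alpha (Cseq body (Cnset a (Nconst 0) (nsucc (nvar a)))) s (t + 1) s2.
  apply: exec_seq E1 _.
  have -> : s2 = State (upd (nmem s1) a (neval s1 (Nconst 0))
                          (neval s1 (nsucc (nvar a)))) (rmem s1).
    by rewrite /s2 /= s1i addn1.
  exact: exec_nset.
have A2 : agree c s s2.
  have [H1 H2] := exec_agree E2; split=> b nb; [apply: H1|apply: H2].
    by move: nb; rewrite /= !inE !negb_or mem_cat !inE => /andP[_].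
  exact: nb.
have ik' : (i.+1 + k)%N = N by rewrite -ik addSnnS.
have s2i : nmem s2 a 0%N = i.+1 by rewrite /= /upd !eqxx.
have [t3 [s3 [E3 t3T I3]]] := IH i.+1 s2 ik' (agree_trans As A2) s2i I1.
exists ((t + 1) + t3).+1, s3; split=> //.
  by apply: exec_while_step E2 E3; rewrite /= (eN _ As) si addn1.
by rewrite mulSn; lia.
Qed.

(** * The algorithm *)

(* Working memory: natural array 6 holds the jobs sorted by size, 7 and 8 the
   outer and inner loop counters, 9 the rank being computed, 10 the offsets and
   11 the offsets modulo m; real array 4 holds the relative speeds, and cell 0
   of the real arrays 5 and 6 the total weight and the scale. *)
Definition cur_job : nexp := Nget 6 (nvar 7).
Definition cur_size : nexp := Nget 1 cur_job.
Definition inner_job : nexp := Nget 6 (nvar 8).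

Definition inner_precedes : bexp :=
  Band (Bnle (Nget 1 (nvar 8)) (Nget 1 (nvar 7)))
    (Bnot (Band (Bnle (Nget 1 (nvar 7)) (Nget 1 (nvar 8)))
             (Bnle (nvar 7) (nvar 8)))).

(** Predecessors are counted and the job is written straight into the cell of its rank; quadratic
    time suffices. *)
Definition sort_jobs : cmd :=
  for_loop 7 (nvar 0)
    (Cseq (Cnset 9 (Nconst 0) (Nconst 0))
    (Cseq (for_loop 8 (nvar 0)
       (Cif inner_precedes (Cnset 9 (Nconst 0) (nsucc (nvar 9))) Cskip))
    (Cnset 6 (nvar 9) (nvar 7)))).

(** Mirrors [density]; halves are inverses of embedded naturals, since programs contain no real
    constants. *)
Definition cur_density : rexp :=
  Radd (rdiv (rsub (Rofnat (Nsub (nvar 0) (nvar 7))) (Rinv (Rofnat (Nconst 2))))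
             (Rofnat (Nget 0 (Nconst 1))))
       (Rinv (Rmul (Rofnat (Nconst 2)) (Rofnat cur_size))).

Definition cur_end : nexp := Nadd (Nget 11 (nvar 7)) cur_size.

(* Block i is written as the triples i and n + i; the second one is the part
   wrapped around, empty (by truncated subtraction) if there is none. *)
Definition place_jobs : cmd :=
  for_loop 7 (nvar 0)
    (Cseq (Crset 4 (nvar 7) (Rpow Einv_alpha cur_density))
    (Cseq (Crset 5 (Nconst 0) (Radd (Rget 5 (Nconst 0))
       (Rmul (Rofnat cur_size) (rdiv cur_density (Rget 4 (nvar 7))))))
    (Cseq (Cnset 10 (nsucc (nvar 7)) (Nadd (Nget 10 (nvar 7)) cur_size))
    (Cseq (Cnset 3 (nvar 7) cur_job)
    (Cseq (Cnset 4 (nvar 7) (Nget 11 (nvar 7)))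
    (Cseq (Cnset 5 (nvar 7) cur_end)
    (Cseq (Cnset 3 (Nadd (nvar 0) (nvar 7)) cur_job)
    (Cseq (Cnset 4 (Nadd (nvar 0) (nvar 7)) (Nconst 0))
    (Cseq (Cnset 5 (Nadd (nvar 0) (nvar 7)) (Nsub cur_end (Nget 0 (Nconst 1))))
    (Cif (Bnle (Nget 0 (Nconst 1)) cur_end)
       (Cnset 11 (nsucc (nvar 7)) (Nsub cur_end (Nget 0 (Nconst 1))))
       (Cnset 11 (nsucc (nvar 7)) cur_end))))))))))).

(** All jobs share the same [W], so it is read off job 0. Each job has two triples, hence twice [n]
    as their number. *)
Definition compute_scale : cmd :=
  Cseq (Cnset 2 (Nconst 0) (Nadd (nvar 0) (nvar 0)))
    (Crset 6 (Nconst 0) (Rpow Einv_alpha_pred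
      (rdiv (Rmul (Rpow Ealpha (rdiv (Rget 1 (Nconst 0)) (Rofnat (Nget 1 (Nconst 0)))))
               (Rget 5 (Nconst 0)))
            (Rget 0 (Nconst 0))))).

Definition inner_completion : rexp :=
  Radd (Rget 2 inner_job) (Rget 3 inner_job).

Definition start_jobs : cmd :=
  for_loop 7 (nvar 0)
    (Cseq (Crset 3 cur_job (rdiv (Rget 6 (Nconst 0)) (Rget 4 (nvar 7))))
    (Cseq (Crset 2 cur_job (Rofnat (Nconst 0)))
    (for_loop 8 (nvar 7)
       (Cif (Band (Bnle (nsucc (Nadd (Nget 10 (nvar 8)) (Nget 0 (Nconst 1))))
                        (Nget 10 (nsucc (nvar 7))))
                  (Brle (Rget 2 cur_job) inner_completion))
          (Crset 2 cur_job inner_completion) Cskip)))).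

Definition schedule_program : cmd :=
  Cseq sort_jobs (Cseq place_jobs (Cseq compute_scale start_jobs)).

(** * Correctness and running time of the program *)

Section Correctness.
Variables (R : realType) (alpha : R) (I : instance R).
Local Notation n := (njobs I).
Local Notation m := (nproc I).

(** The program never writes to arrays 0 and 1, so this persists through all its phases. *)
Definition has_input (s : state R) : Prop :=
  forall a, (a < 2)%N ->
    nmem s a = nmem (encode_instance I) a /\ rmem s a = rmem (encode_instance I) a.

Lemma agree_input c s s' :
  all (leq 2) (nwrites c) -> all (leq 2) (rwrites c) ->
  agree c s s' -> has_input s -> has_input s'.
Proof.
move=> /allP nc /allP rc [H1 H2] Hs a a2.
rewrite H1 ?H2; first exact: Hs.
  by apply/negP => /rc; rewrite leqNgt a2.
by apply/negP => /nc; rewrite leqNgt a2.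
Qed.

Lemma input_nset s a i v : (2 <= a)%N ->
  has_input s -> has_input (State (upd (nmem s) a i v) (rmem s)).
Proof.
move=> a2 Hs b b2; rewrite /= upd_other; first exact: Hs.
by rewrite neq_ltn (leq_trans b2 a2).
Qed.

Lemma input_jsize s (j : 'I_n) : has_input s -> nmem s 1 j = jsize j.
Proof. by move=> /(_ 1%N isT)[-> _] /=; rewrite /of_fun valK. Qed.

Lemma input_njobs s : has_input s -> nmem s 0 0%N = n.
Proof. by move=> /(_ 0%N isT)[->]. Qed.

Lemma input_nproc s : has_input s -> nmem s 0 1%N = m.
Proof. by move=> /(_ 0%N isT)[->]. Qed.

Lemma sort_jobs_correct s (sigma : {perm 'I_n}) :
  has_input s -> (forall i, rank (@jsize R I) (sigma i) = i) ->
  wp alpha sort_jobs s (n * ((n * 4 + 4) + 2) + 2)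
    (fun s' => forall i : 'I_n, nmem s' 6 i = sigma i).
Proof.
move=> Hs sigmaE.
apply: (@wp_mono _ _ _ _ _ _ (fun s' => forall j : 'I_n, (j < n)%N ->
  nmem s' 6 (rank (@jsize R I) j) = j)) (leqnn _) _ _.
  by move=> s' _ H i; rewrite -{1}(sigmaE i) H.
apply: (wp_for (Inv := fun i s' => forall j : 'I_n, (j < i)%N ->
  nmem s' 6 (rank (@jsize R I) j) = j)) => //.
  by move=> s' /agree_input H; apply/input_njobs/H.
move=> i s1 ltin /agree_input/(_ Hs) H1.
have {H1} Hs1 : has_input s1 by apply: H1.
move=> s1i Is1; pose i' := Ordinal ltin.
rewrite (_ : n * 4 + 4 = (n * (2 + 2) + 2 + 1).+1)%N; last by lia.
apply: wp_seqn; rewrite /=; set s2 := State _ _.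
have Hs2 : has_input s2 by apply: input_nset.
apply: (@wp_seq _ _ _ _ _ _ _ (fun s' => nmem s' 9 0%N = rank (@jsize R I) i')).
  apply: (@wp_mono _ _ _ _ _ _ (fun s' => nmem s' 9 0%N =
     \sum_(k < n | (k < n)%N) precedes (@jsize R I) k i')%N) (leqnn _) _ _.
    by move=> s' _ ->; apply: eq_bigl => k; rewrite ltn_ord.
  apply: (wp_for (Inv := fun k0 s' => nmem s' 9 0%N =
     \sum_(k < n | (k < k0)%N) precedes (@jsize R I) k i')%N) => //.
  - by move=> s' /agree_input H; apply/input_njobs/H.
  - by rewrite big_pred0.
  - move=> k s3 ltkn A3 s3k Is3; pose k' := Ordinal ltkn.
    have Hs3 : has_input s3 by apply: agree_input A3 Hs2.
    have s3i : nmem s3 7 0%N = i by have [-> //] := A3; rewrite /= upd_other.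
    have precE : beval alpha s3 inner_precedes = precedes (@jsize R I) k' i'.
      by rewrite /= s3k s3i -[k]/(val k') -[i]/(val i') !input_jsize.
    have sumE : (\sum_(l < n | (l < k.+1)%N) precedes (@jsize R I) l i'
        = precedes (@jsize R I) k' i' + nmem s3 9 0)%N.
      rewrite Is3 (bigD1 k')//=; congr addn; apply: eq_bigl => l.
      by rewrite -val_eqE /= ltnS [RHS]ltn_neqAle andbC.
    apply: wp_if; rewrite precE; case: ifP => pE.
      by apply: wp_nset; rewrite /= sumE pE /upd /= addn1.
    by apply: wp_skip; rewrite /= sumE pE /upd.
move=> s3 A3 s3r; apply: wp_nset => j; rewrite ltnS leq_eqVlt /=.
have [A3n _] := A3.
have s3i : nmem s3 7 0%N = i by rewrite A3n //= upd_other.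
have s36 : nmem s3 6 = nmem s1 6 by rewrite A3n //= upd_other.
rewrite s3r s3i {1}/upd /= {1}/upd /= s36.
have [ji|ji] := eqVneq (j : nat) i.
  by have -> : j = i' by [exact: val_inj]; rewrite eqxx.
(* Earlier entries survive because distinct jobs have distinct ranks. *)
by rewrite /= => lt; rewrite (inj_eq (@rank_inj _ _ _ _)) -val_eqE /= (negbTE ji) Is1.
Qed.


(** The invariant of [place_jobs] after [k] jobs. Offsets are known up to [k] itself, since the next
    round reads entry [k]. *)
Definition placed (sigma : {perm 'I_n}) (k : nat) (s : state R) : Prop :=
  [/\ forall l : 'I_n, (l < k)%N -> rmem s 4 l = rel_speed alpha sigma l,
      rmem s 5 0%N = \sum_(l < k) (sorted_size sigma l)%:R
                       * (density sigma l / rel_speed alpha sigma l),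
      forall l, (l <= k)%N -> nmem s 10 l = offset sigma l,
      nmem s 11 k = (offset sigma k %% m)%N
    & forall l : 'I_n, (l < k)%N ->
        [/\ nmem s 3 l = sigma l, nmem s 3 (n + l)%N = sigma l,
            nmem s 4 l = (offset sigma l %% m)%N, nmem s 4 (n + l)%N = 0%N
          & nmem s 5 l = (offset sigma l %% m + sorted_size sigma l)%N /\
            nmem s 5 (n + l)%N = (offset sigma l %% m + sorted_size sigma l - m)%N]].

Lemma place_jobs_correct s (sigma : {perm 'I_n}) :
  (forall j : 'I_n, (0 < jsize j)%N) ->
  (forall j : 'I_n, (2 * jsize j <= m)%N) ->
  has_input s -> (forall i : 'I_n, nmem s 6 i = sigma i) ->
  nmem s 10 0%N = 0%N -> nmem s 11 0%N = 0%N -> rmem s 5 0%N = 0 ->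
  wp alpha place_jobs s (n * (11 + 2) + 2) (placed sigma n).
Proof.
move=> s_gt0 s_half Hs s6 s10 s11 r5; apply: wp_for => //.
- by move=> s' /agree_input H; apply/input_njobs/H.
- split=> //=; rewrite ?big_ord0 //.
    by move=> l; rewrite leqn0 => /eqP->; rewrite /offset big_ord0 upd_other.
  by rewrite /offset big_ord0 mod0n upd_other.
move=> k s1 ltkn A1 s1k [I1 I2 I3 I4 I5]; pose k' := Ordinal ltkn.
have Hs1 : has_input s1 by apply: agree_input A1 Hs.
have s16 : nmem s1 6 k = sigma k'.
  by have [-> //] := A1; rewrite -[k]/(val k') s6.
have n1 := input_njobs Hs1; have m1 := input_nproc Hs1.
have sz : nmem s1 1 (nmem s1 6 k) = sorted_size sigma k.
  by rewrite s16 (input_jsize _ Hs1) -[k]/(val k') sorted_sizeE.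
have e10 : nmem s1 10 k = offset sigma k by exact: I3.
have szm := sorted_size_half sigma s_half k.
have m_gt0 : (0 < m)%N by have := s_gt0 k'; have := s_half k'; lia.
have Pm := ltn_pmod (offset sigma k) m_gt0.
do 9 (first [apply: wp_seqn | apply: wp_seqr]).
apply: wp_if; rewrite /upd /= !eqxx s1k n1 m1 sz I4 e10 s16.
rewrite -/(density sigma k) -/(rel_speed alpha sigma k).
set P := (offset sigma k %% m)%N in Pm I4 *.
set z := sorted_size sigma k in sz szm *.
set s2 := State _ _.
(* A residue below [m] plus a size of at most [m / 2] stays below [2 m], so one conditional
   subtraction computes the remainder. *)
have modS : (offset sigma k.+1 %% m = if m <= P + z then P + z - m else P + z)%N.
  rewrite offsetS -modnDml -/P -/z; case: leqP => Pz; last by rewrite modn_small.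
  by rewrite -{1}(subnK Pz) modnDr modn_small //; lia.
(* Both branches write the residue of the next offset; the invariant is checked once for that
   value. *)
suff fin v : v = (offset sigma k.+1 %% m)%N -> placed sigma k.+1
    (State (upd (upd (nmem s2) 11 (k + 1) v) 7 0 k.+1)%N (rmem s2)).
  have s27 : neval s2 (nsucc (nvar 7)) = (k + 1)%N by rewrite /= s1k.
  have s2e : neval s2 cur_end = (P + z)%N.
    by rewrite /= s1k ?(ltn_eqF (leq_addr _ _)) I4 sz.
  have s2m : neval s2 (Nget 0 (Nconst 1)) = m by rewrite /= m1.
  case: ifP modS => c modS; apply: wp_nset; rewrite s27; apply: fin;
    by rewrite modS -s2e -?s2m.
move=> ->; split.
- move=> l; rewrite ltnS leq_eqVlt => /orP[/eqP lk|lk]; rewrite /s2 /=.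
    by rewrite lk eqxx.
  by rewrite (ltn_eqF lk) I1.
- by rewrite /s2 /= big_ord_recr /= I2.
- move=> l; rewrite /s2 /upd /= addn1 leq_eqVlt => /orP[/eqP->|lk].
    by rewrite eqxx offsetS.
  by rewrite (ltn_eqF lk) I3.
- by rewrite /upd /= addn1 eqxx.
move=> l; have nl := ltn_ord l; rewrite ltnS leq_eqVlt /s2 /upd /=.
have ne1 : (l == n + k :> nat)%N = false by apply/negbTE; lia.
have ne2 : (n + l == k)%N = false by apply/negbTE; lia.
rewrite ne1 ne2 eqn_add2l => /orP[/eqP lk|lk].
  have -> : l = k' by exact: val_inj.
  by rewrite /= eqxx.
by rewrite (ltn_eqF lk); exact: I5.
Qed.

(** An earliest start depends only on earlier completions, so writing the times of later jobs
    preserves it. *)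
Lemma earliest_start_ext sigma x (f g : 'I_n -> R) i k :
  (forall l : 'I_n, (l < k)%N -> f l = g l) ->
  earliest_start sigma x f i k -> earliest_start sigma x g i k.
Proof.
move=> fg [H1 H2 H3]; split=> // [l lk bl|]; first by rewrite -fg// H2.
by case: H3 => [|[l [lk bl ->]]]; [left | right; exists l; rewrite fg].
Qed.

Lemma earliest_startS sigma x (f : 'I_n -> R) i (k : 'I_n) :
  earliest_start sigma x f i k ->
  earliest_start sigma (if blocks sigma k i && (x <= f k) then f k else x) f i k.+1.
Proof.
move=> [H1 H2 H3]; case: ifP => [/andP[bk xf]|nb].
  split; first exact: le_trans xf.
    move=> l; rewrite ltnS leq_eqVlt => /orP[/eqP lk _|lk bl].
      by have -> : l = k by exact: val_inj.
    exact: le_trans (H2 l lk bl) xf.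
  by right; exists k.
split=> //.
  move=> l; rewrite ltnS leq_eqVlt => /orP[/eqP lk|]; last exact: H2.
  have -> : l = k by exact: val_inj.
  by move=> bk; move: nb; rewrite bk /= => /negbT; rewrite -ltNge => /ltW.
case: H3 => [|[l [lk bl xE]]]; [by left | right; exists l; split=> //].
exact: ltnW.
Qed.

Lemma start_jobs_correct s (sigma : {perm 'I_n}) (c : R) :
  has_input s -> (forall i : 'I_n, nmem s 6 i = sigma i) ->
  (forall l, (l <= n)%N -> nmem s 10 l = offset sigma l) ->
  (forall l : 'I_n, rmem s 4 l = rel_speed alpha sigma l) -> rmem s 6 0%N = c ->
  wp alpha start_jobs s (n * ((n * 4 + 4) + 2) + 2)
    (fun s' => forall l : 'I_n, (l < n)%N ->
       rmem s' 3 (sigma l) = c / rel_speed alpha sigma l /\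
       earliest_start sigma (rmem s' 2 (sigma l))
         (fun j => rmem s' 2 (sigma j) + rmem s' 3 (sigma j)) l l).
Proof.
move=> Hs s6 s10 r4 r6.
apply: (wp_for (Inv := fun k s' => forall l : 'I_n, (l < k)%N ->
       rmem s' 3 (sigma l) = c / rel_speed alpha sigma l /\
       earliest_start sigma (rmem s' 2 (sigma l))
         (fun j => rmem s' 2 (sigma j) + rmem s' 3 (sigma j)) l l)) => //.
  by move=> s' /agree_input H; apply/input_njobs/H.
move=> k s1 ltkn A1 s1k I1; pose k' := Ordinal ltkn.
have [A1n A1r] := A1; have Hs1 : has_input s1 by apply: agree_input A1 Hs.
have s16 (i : 'I_n) : nmem s1 6 i = sigma i by rewrite A1n // s6.
have s16k : nmem s1 6 k = sigma k' by rewrite -[k]/(val k') s16.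
have sigma_eq (i j : 'I_n) : (sigma i == sigma j :> nat) = (i == j :> nat).
  by rewrite (inj_eq val_inj) (inj_eq perm_inj).
rewrite (_ : n * 4 + 4 = (n * 4 + 2).+2)%N; last by lia.
apply: wp_seqr; apply: wp_seqr.
rewrite /= /upd /= s1k s16k (A1r 6) // (A1r 4) // -[k in rmem s 4 k]/(val k') r4 r6.
set s2 := State _ _.
have r22 (l : 'I_n) : (l < k)%N -> rmem s2 2 (sigma l) = rmem s1 2 (sigma l).
  by move=> lk; rewrite /s2 /= sigma_eq /= (ltn_eqF lk).
have r23 (l : 'I_n) : (l < k)%N -> rmem s2 3 (sigma l) = rmem s1 3 (sigma l).
  by move=> lk; rewrite /s2 /= sigma_eq /= (ltn_eqF lk).
have r23k : rmem s2 3 (sigma k') = c / rel_speed alpha sigma k.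
  by rewrite /s2 /= eqxx.
pose f (j : 'I_n) := rmem s1 2 (sigma j) + rmem s1 3 (sigma j).
(* The inner loop leaves earlier times alone, so its running maximum is stated with the completions
   [f] fixed beforehand. *)
apply: (@wp_mono _ _ _ _ (k * (2 + 2) + 2) _ (fun s' =>
  (forall l : 'I_n, (l < k)%N -> rmem s' 2 (sigma l) = rmem s1 2 (sigma l)) /\
  earliest_start sigma (rmem s' 2 (sigma k')) f k k)); first by lia.
  move=> s' [_ Ar] [H1 H2] l; rewrite ltnS leq_eqVlt /= (Ar 3)// => /orP[/eqP lk|lk].
    have -> : l = k' by exact: val_inj.
    split; first exact: r23k.
    by apply: earliest_start_ext H2 => j jk; rewrite H1// r23.
  have [J1 J2] := I1 l lk; rewrite r23// H1//; split=> //.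
  by apply: earliest_start_ext J2 => j jl; rewrite H1 ?r23// (ltn_trans jl).
apply: (wp_for (Inv := fun k0 s' =>
  (forall l : 'I_n, (l < k)%N -> rmem s' 2 (sigma l) = rmem s1 2 (sigma l)) /\
  earliest_start sigma (rmem s' 2 (sigma k')) f k k0)) => //.
- by move=> s' [/(_ 7%N isT) s'7 _]; rewrite /= s'7.
- split=> //; rewrite /= eqxx; split=> //; by left.
move=> k0 s3 ltk0 [A3n A3r] s3k0 [H1 H2].
pose k0' := Ordinal (ltn_trans ltk0 ltkn).
have s36 (i : 'I_n) : nmem s3 6 i = sigma i by rewrite A3n //= s16.
have s37 : nmem s3 7 0%N = k by rewrite A3n.
have s310 l : nmem s3 10 l = nmem s 10 l by rewrite A3n //= A1n.
have s3m : nmem s3 0 1%N = m by rewrite A3n //; exact: input_nproc Hs1.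
apply: wp_if; rewrite /= s3k0 s37 s3m !s310 (s36 k') -[k0]/(val k0') (s36 k0') /=.
rewrite !s10 ?addn1; [|by lia|by lia].
rewrite (H1 k0')// (A3r 3)// (r23 k0')// -/(f k0') -/(blocks sigma k0 k).
have := earliest_startS (k := k0') H2; rewrite /=; case: ifP => bk H3.
  apply: wp_rset; rewrite /= s3k0 s37 (s36 k') -[k0]/(val k0') (s36 k0') /= /upd /=.
  rewrite eqxx (H1 k0')// (A3r 3)// (r23 k0')//; split=> // l lk.
  by rewrite sigma_eq /= (ltn_eqF lk) H1.
by apply: wp_skip; split.
Qed.

(** Triples below [n] give the main interval, cut at [m] because processors range over ['I_m]; those
    from [n] on give the wrapped part. *)
Lemma decode_cyclic_procs (s : state R) (sigma : {perm 'I_n}) (i : 'I_n) :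
  nmem s 2 0%N = (n + n)%N -> placed sigma n s ->
  procs (decode_schedule I s) (sigma i) = cyclic_procs sigma i.
Proof.
move=> s2 [_ _ _ _ P]; apply/setP => r; rewrite !inE.
have [Pi1 Pi2 Pi3 Pi4 [Pi5 Pi6]] := P i (ltn_ord i).
apply/existsP/orP => [[k /andP[]]|].
  have := ltn_ord k; rewrite {2}s2; have [kn _|nk knn] := ltnP k n.
    have [-> _ -> _ [-> _]] := P (Ordinal kn) kn.
    by rewrite (inj_eq val_inj) (inj_eq perm_inj) => /eqP <- ?; left.
  have kn : (k - n < n)%N by lia.
  have [] := P (Ordinal kn) kn; rewrite /= subnKC// => _ -> _ -> [_ ->].
  by rewrite (inj_eq val_inj) (inj_eq perm_inj) => /eqP <- ?; right.
have ltn2 : (n + i < nmem s 2 0)%N by rewrite s2 ltn_add2l.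
have lt2 : (i < nmem s 2 0)%N by rewrite s2 ltn_addl.
case=> H; [exists (Ordinal lt2) | exists (Ordinal ltn2)] => /=.
  by rewrite Pi1 Pi3 Pi5 eqxx.
by rewrite Pi2 Pi4 Pi6 eqxx leq0n.
Qed.

Lemma schedule_program_correct :
  1 < alpha -> well_formed I -> half_size_equal_work I ->
  wp alpha schedule_program (encode_instance I) (100 * (n + 1) ^ 2)
    (fun s => approx_schedule alpha 2 (decode_schedule I s)).
Proof.
move=> alpha_gt1 [s_gt0 _ E_gt0] [s_half [W W_gt0 workE]].
have [sigma [rankE sortedE]] := rank_perm (@jsize R I).
(* The sum of the bounds for the four phases, quadratic in [n]; the constant 100 is generous. *)
pose T := ((n * ((n * 4 + 4) + 2) + 2)
  + ((n * (11 + 2) + 2) + (2 + (n * ((n * 4 + 4) + 2) + 2))))%N.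
have TE : (T <= 100 * (n + 1) ^ 2)%N by rewrite /T; nia.
apply: (wp_mono TE (fun s' _ H => H)); rewrite {TE}/T.
have s0i : has_input (encode_instance I) by [].
apply: wp_seq (sort_jobs_correct s0i rankE) _ => s1 A1 perm1.
have s1i : has_input s1 by exact: agree_input A1 s0i.
have [A1n A1r] := A1.
apply: (wp_seq (place_jobs_correct s_gt0 s_half s1i perm1 _ _ _)).
- by rewrite A1n.
- by rewrite A1n.
- by rewrite A1r.
move=> s2 A2 placed2; have s2i : has_input s2 by exact: agree_input A2 s1i.
have [A2n A2r] := A2; have [slow2 F2 off2 _ _] := placed2.
pose Q3 s := rmem s 6 0%N = powR
   (powR (rmem s2 1 0%N / (nmem s2 1 0%N)%:R) alpha * rmem s2 5 0%N / rmem s2 0 0%N)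
   (alpha - 1)^-1 /\ nmem s 2 0%N = (n + n)%N.
apply: (@wp_seq _ _ _ _ _ _ _ Q3).
  by apply: wp_seqn; apply: wp_rset; split=> //=; rewrite /upd /= (input_njobs s2i).
move=> s3 A3 [c3 K3]; have s3i : has_input s3 by exact: agree_input A3 s2i.
have [A3n A3r] := A3.
have perm3 (i : 'I_n) : nmem s3 6 i = sigma i by rewrite A3n// A2n.
have off3 l : (l <= n)%N -> nmem s3 10 l = offset sigma l by rewrite A3n//; exact: off2.
have slow3 (l : 'I_n) : rmem s3 4 l = rel_speed alpha sigma l by rewrite A3r// slow2.
apply: wp_mono (leqnn _) _ (start_jobs_correct s3i perm3 off3 slow3 c3) => s4 [A4n A4r] H.
apply: (@cyclic_approx _ _ _ sigma alpha_gt1 s_gt0 s_half E_gt0 W W_gt0 workE) => //.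
- move=> i; rewrite /=; have [-> _] := H i (ltn_ord i).
  (* Job 0 exists because [i] does; its work, computed by the program, is [W]. *)
  have n_gt0 : (0 < n)%N := leq_ltn_trans (leq0n i) (ltn_ord i).
  congr (_ / _); rewrite /scale F2; congr (powR (powR _ _ * _ / _) _).
    rewrite -(workE (Ordinal n_gt0)) /work.
    have [-> ->] := s2i 1%N isT; rewrite /= /of_fun.
    by rewrite -[0%N]/(val (Ordinal n_gt0)) valK.
  by have [_ ->] := s2i 0%N isT.
- move=> i; apply: decode_cyclic_procs; first by rewrite A4n.
  have [_ _ _ P4 P5] := placed2; split.
  + by move=> l _; rewrite A4r// slow3.
  + by rewrite A4r// A3r.
  + by move=> l ln; rewrite A4n// off3.
  + by rewrite A4n// A3n.
  + by move=> l ln; rewrite !A4n// !A3n//; exact: P5.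
- by move=> i; have [_] := H i (ltn_ord i).
Qed.

Lemma njobs_le_input_size : (n <= input_size I)%N.
Proof.
rewrite /input_size; apply: leq_trans (leq_addl _ _).
rewrite -[leqLHS]card_ord -sum1_card; apply: leq_sum => j _.
by rewrite addn1.
Qed.

End Correctness.

Theorem theorem2 (R : realType) (alpha : R) (halpha : 1 < alpha) :
  exists (prog : cmd) (P : {poly nat}),
  forall I : instance R,
    well_formed I -> half_size_equal_work I ->
    exists (t : nat) (s : state R),
      [/\ exec alpha prog (encode_instance I) t s,
          (t <= P.[input_size I])%N
        & approx_schedule alpha 2 (decode_schedule I s)].
Proof.
exists schedule_program, (100%:P * ('X + 1%:P) ^+ 2) => I wf half.
have [t [s [E tT A]]] := schedule_program_correct halpha wf half.
exists t, s; split=> //; apply: leq_trans tT _.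
have le : (njobs I + 1 <= input_size I + 1)%N by rewrite leq_add2r njobs_le_input_size.
by rewrite !hornerE; apply: leq_mul => //; apply: leq_mul.
Qed.
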